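(* Let $K/\mathbb{Q}$ be a number field with ring of integers $\mathcal{O}_K$. There exists a constant $c_K>0$ depending only on $K$ such that the following holds. Let $\mathcal{A}=\{a_1+I_1,\dots,a_n+I_n\}$, with $a_1,\dots,a_n\in\mathcal{O}_K$ and $I_1,\dots,I_n$ distinguishable ideals of $\mathcal{O}_K$, be a covering system of $\mathcal{O}_K$ (i.e. $\mathcal{O}_K=\bigcup_{i=1}^n(a_i+I_i)$) of multiplicity $s$. Then \[ \min_{1\le i\le n}\mathrm{N}(I_i)\le \exp\big(c_K\log^2(s+1)/\log\log(s+2)\big). \]
   Context: For a nonzero ideal $I\subseteq\mathcal{O}_K$, $\mathrm{N}(I)=[\mathcal{O}_K:I]$ denotes its norm. An ideal $I$ is called distinguishable if among the prime ideal factors of $I$ there is a unique one of largest norm. The multiplicity of a finite collection $\mathcal{A}=\{a_1+I_1,\dots,a_n+I_n\}$ of congruence classes is $m(\mathcal{A})=\max_{I}\#\{1\le j\le n: I_j=I\}$, the largest number of times a single modulus occurs. *)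

(* Defs.v *)
From Stdlib Require Import Reals ClassicalEpsilon.
From mathcomp Require Import all_boot all_algebra all_field.
Set Implicit Arguments. Unset Strict Implicit. Unset Printing Implicit Defensive.
Import GRing.Theory.

Section NF.
Variable K : fieldExtType rat.
Local Open Scope ring_scope.

Definition integral (x : K) : Prop :=
  exists p : {poly int}, p \is monic /\ root (map_poly (fun z : int => (intmul (1 : K) z)) p) x.

Definition is_ideal (I : K -> Prop) : Prop :=
  [/\ (forall x, I x -> integral x), I 0,
      (forall x y, I x -> I y -> I (x - y))
    & (forall r x, integral r -> I x -> I (r * x))].

Definition nonzero_ideal (I : K -> Prop) : Prop :=
  is_ideal I /\ exists x, I x /\ x != 0.

Definition prime_ideal (P : K -> Prop) : Prop :=
  [/\ is_ideal P, ~ P 1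
    & forall a b, integral a -> integral b -> P (a * b) -> P a \/ P b].

Definition same_set (X Y : K -> Prop) : Prop := forall x, X x <-> Y x.

Definition ideal_norm_is (I : K -> Prop) (N : nat) : Prop :=
  exists reps : seq K,
    [/\ size reps = N, (forall i, (i < N)%N -> integral (nth 0 reps i)),
        (forall i j, (i < N)%N -> (j < N)%N ->
            I (nth 0 reps i - nth 0 reps j) -> i = j)
      & (forall x, integral x -> exists2 i, (i < N)%N & I (x - nth 0 reps i))].

(* prime ideal factors of a nonzero ideal I = prime ideals containing I *)
Definition prime_factor (I P : K -> Prop) : Prop :=
  prime_ideal P /\ (forall x, I x -> P x).

Definition distinguishable (I : K -> Prop) : Prop :=
  exists P, exists nP, prime_factor I P /\ ideal_norm_is P nP /\
    forall Q nQ, prime_factor I Q -> ~ same_set Q P -> ideal_norm_is Q nQ -> (nQ < nP)%N.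

Definition covering_system (n : nat) (a : 'I_n -> K) (I : 'I_n -> K -> Prop) : Prop :=
  forall x, integral x -> exists i : 'I_n, I i (x - a i).

Definition same_setb (X Y : K -> Prop) : bool :=
  if excluded_middle_informative (same_set X Y) then true else false.

Definition multiplicity (n : nat) (I : 'I_n -> K -> Prop) : nat :=
  \max_(j : 'I_n) #|[set k : 'I_n | same_setb (I k) (I j)]|.
End NF.

Definition cover_bound (c : R) (s : nat) : R :=
  exp (Rdiv (Rmult c (Rmult (ln (Rplus (INR s) 1)) (ln (Rplus (INR s) 1))))
            (ln (ln (Rplus (INR s) 2)))).

(* Main.v *)
Require Import Defs.
From Stdlib Require Import Reals.
From mathcomp Require Import all_boot all_order all_algebra all_field.
From mathcomp Require Import all_classical reals sequences exp.
From mathcomp Require Import ring lra zify.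
Set Implicit Arguments. Unset Strict Implicit. Unset Printing Implicit Defensive.
Import Order.TTheory GRing.Theory Num.Theory.

(** A derandomized form of the distortion method of Balister, Bollobas, Morris, Sahasrabudhe
    and Tiba.  By unique factorization and the Chinese remainder theorem a class [a + I]
    becomes a box in a product of the finite rings [O / P_i ^ e], the primes [P_i] being sorted
    by norm.  The coordinates of an uncovered point are chosen one at a time, always avoiding
    the boxes that end at the current coordinate.  This is possible as long as these boxes
    fill less than half of the fibre, which is ensured by a potential, an upper bound for
    the first moments (norm of [P_i] at most [T = (s + 2) ^ B]) and second moments (larger
    norms) of the densities still to come; it can be kept from increasing because restricting
    the choice to half of the fibre at most doubles an average.

    The initial potential is less than 1 if all moduli are large: the first moments are sums
    of [1 / N I] over [T]-smooth ideals, treated by Rankin's trick with exponent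
    [ln ln T / (2 ln T)], the second moments are at most a multiple of
    [s ^ 2 * sum of N P ^ (- 7 / 4)] over [N P > T].  The only input about primes is
    [sum_(p <= n) ln p / p <= 2 ln n], read off from the factorization of [n!], together with
    the fact that at most [[K : Q]] prime ideals contain a given [p]. *)

(** * Ideals of the ring of integers *)

Section Ideals.
Variable K : fieldExtType rat.
Local Open Scope ring_scope.
Implicit Types (x y z u v w : K) (I P Q : K -> Prop).

(** First moments alone cannot work at all norms: up to slowly growing factors they add up like
    [s / N P], which diverges, whereas squares add up like [s ^ 2 / N P ^ 2], with a tail that a
    power of [s] beats. At small norms the squares have no reason to be small, and there the size of
    the moduli must enter. This forces the cut at a power of [s]. The Rankin exponent makes [T ^ sg]
    the square root of [ln T]. The Euler product then costs [exp (O (ln T))], a fixed power of [s],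
    while a modulus of norm [M] gains [M ^ sg]. Balancing the two gives [ln M] of order
    [ln T ^ 2 / ln ln T], the shape of the bound. Products of ideals are never formed: a prime
    becomes principal after localization, the exponent of [P] in [I] is the largest [k] for which
    [I] lies in the localized [k]-th power, and [I] is recovered from its exponents prime by prime.
    Finiteness of residue rings comes from independence modulo [p], without an integral basis, and
    is exploited by pigeonhole arguments. *)

Lemma integralP x : integral x <-> integralOver (intmul (1 : K)) x.
Proof. by split=> [[p [? ?]]|[p ? ?]]; exists p. Qed.

Lemma intrK_eq0 (n : int) : ((n%:~R : K) == 0) = (n == 0).
Proof. by rewrite -(scaler_int n (1 : K)) scaler_eq0 oner_eq0 orbF intr_eq0. Qed.

Lemma intrK_inj : injective (intmul (1 : K)).
Proof.
by move=> m n /eqP; rewrite -subr_eq0 -intrB intrK_eq0 subr_eq0 => /eqP.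
Qed.

Lemma integral_int (n : int) : integral (n%:~R : K).
Proof. by apply/integralP; exact: integral_id. Qed.

Lemma integralO0 : integral (0 : K).
Proof. exact: (integral_int 0). Qed.

Lemma integralO1 : integral (1 : K).
Proof. exact: (integral_int 1). Qed.

Lemma integralOn (n : nat) : integral (n%:R : K).
Proof. exact: (integral_int n). Qed.

Lemma integralB x y : integral x -> integral y -> integral (x - y).
Proof. by rewrite !integralP; exact: integral_sub. Qed.

Lemma integralD x y : integral x -> integral y -> integral (x + y).
Proof. by rewrite !integralP; exact: integral_add. Qed.

Lemma integralM x y : integral x -> integral y -> integral (x * y).
Proof. by rewrite !integralP; exact: integral_mul. Qed.

Lemma integralN x : integral x -> integral (- x).
Proof. by rewrite !integralP; exact: integral_opp. Qed.

Lemma integralX x n : integral x -> integral (x ^+ n).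
Proof.
move=> ix; elim: n => [|n IH]; first exact: integralO1.
by rewrite exprS; apply: integralM.
Qed.

Lemma integral_sum_seq (T : Type) (r : seq T) (Pr : pred T) (F : T -> K) :
  (forall i, integral (F i)) -> integral (\sum_(i <- r | Pr i) F i).
Proof. by move=> iF; apply: big_ind => //; [exact: integralO0 | exact: integralD]. Qed.

(** [x] is a root of the monic polynomial [X ^ j - X ^ i - c], whose coefficients are integral. In
    [uniformizer] the relation comes from a pigeonhole on powers. *)
Lemma integral_pow_root x c (i j : nat) :
  (i < j)%N -> integral c -> x ^+ j - x ^+ i = c -> integral x.
Proof.
move=> ij ic e; apply/integralP.
pose p : {poly K} := 'X^j - ('X^i + c%:P).
have sz : (size ('X^i + c%:P : {poly K})%R <= j)%N.
  rewrite (leq_trans (size_polyD _ _)) // geq_max size_polyXn ij size_polyC /=.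
  by case: (c != 0) => //; apply: leq_ltn_trans ij.
apply: (@integral_root_monic _ _ _ x p).
- by rewrite monicE lead_coefDl ?lead_coefXn // size_polyN size_polyXn ltnS.
- by rewrite rootE !hornerE opprD addrA e subrr.
- apply/integral_poly => k; apply/integralP; rewrite !coefE.
  apply: integralB; first exact: integralOn.
  apply: integralD; first exact: integralOn.
  by case: ifP => _ //; exact: integralO0.
Qed.

Lemma idealB I x y : is_ideal I -> I x -> I y -> I (x - y).
Proof. by case=> _ _ h _; apply: h. Qed.

Lemma ideal0 I : is_ideal I -> I 0.
Proof. by case. Qed.

Lemma ideal_int I x : is_ideal I -> I x -> integral x.
Proof. by case=> h _ _ _; apply: h. Qed.

Lemma idealMl I x y : is_ideal I -> integral x -> I y -> I (x * y).
Proof. by case=> _ _ _; apply. Qed.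

Lemma idealMr I x y : is_ideal I -> I x -> integral y -> I (x * y).
Proof. by move=> iI Ix iy; rewrite mulrC; apply: idealMl. Qed.

Lemma idealN I x : is_ideal I -> I x -> I (- x).
Proof. by move=> iI Ix; rewrite -(sub0r x); apply: idealB => //; exact: ideal0. Qed.

Lemma idealD I x y : is_ideal I -> I x -> I y -> I (x + y).
Proof. by move=> iI Ix Iy; rewrite -(opprK y); apply: idealB => //; exact: idealN. Qed.

Lemma ideal_sum_seq I (T : Type) (r : seq T) (Pr : pred T) (F : T -> K) :
  is_ideal I -> (forall i, Pr i -> I (F i)) -> I (\sum_(i <- r | Pr i) F i).
Proof.
move=> iI IF; apply: big_ind => //; first exact: ideal0.
by move=> x y; exact: idealD.
Qed.

Lemma ideal_sub_sym I x y : is_ideal I -> I (x - y) -> I (y - x).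
Proof. by move=> iI /(idealN iI); rewrite opprB. Qed.

Lemma ideal_sub_trans I y x z : is_ideal I -> I (x - y) -> I (y - z) -> I (x - z).
Proof. by move=> iI h1 h2; have := idealD iI h1 h2; congr I; ring. Qed.

Lemma nonzero_ideal_nat I : nonzero_ideal I -> exists2 n : nat, (0 < n)%N & I n%:R.
Proof.
move=> [iI [x [Ix x0]]].
have [p [mp rp]] := ideal_int iI Ix.
(* Removing all factors [X] from the equation of [x] leaves [q] with nonzero constant term, still
   vanishing at [x]; so [x] divides that constant term. *)
have [k [q q0 epq]] := multiplicity_XsubC p 0.
have {}q0 : q`_0 != 0.
  move: q0; rewrite (monic_neq0 mp) /= => q0.
  by move: q0; rewrite rootE horner_coef0.
set f := fun z : int => _ in rp.
have rq : root (map_poly f q) x.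
  move: rp; rewrite epq (rmorphM (map_poly (intmul (1 : K)))) /=.
  rewrite (rmorphXn (map_poly (intmul (1 : K)))) /= rootM => /orP[//|].
  rewrite subr0 map_polyX rootE hornerXn expf_eq0 (negPf x0).
  by rewrite andbF.
have eq0 : ((q`_0)%:~R : K) = - (x * \sum_(i < (size q).-1) (q`_i.+1)%:~R * x ^+ i).
  have szq : (0 < size q)%N.
    by rewrite size_poly_gt0; apply: contraNneq q0 => ->; rewrite coef0.
  move: rq; rewrite rootE horner_coef size_map_inj_poly //; last exact: intrK_inj.
  rewrite -(prednK szq) big_ord_recl /= coef_map_id0 // expr0 mulr1 => /eqP e.
  apply/eqP; rewrite -addr_eq0; apply/eqP; rewrite -[RHS]e; congr (_ + _).
  rewrite mulr_sumr; apply: eq_bigr => i _; rewrite coef_map_id0 // /bump add1n exprS /f.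
  by ring.
have Iq : I ((q`_0)%:~R).
  rewrite eq0; apply: idealN => //; apply: idealMr => //.
  apply: integral_sum_seq => i; apply: integralM; first exact: integral_int.
  exact/integralX/(ideal_int iI).
exists (absz (q`_0)%R); first by rewrite absz_gt0.
case: (q`_0) Iq => n /=; first by [].
by rewrite NegzE mulrNz => /(idealN iI); rewrite opprK.
Qed.

(** Repetitions modulo [I] are allowed, unlike in [ideal_norm_is]: such lists are easier to build
    and already bound the norm and feed the pigeonhole principle. *)
Definition covers I (s : seq K) : Prop :=
  (forall r, r \in s -> integral r) /\
  (forall x, integral x -> exists2 r, r \in s & I (x - r)).

Lemma covers_pigeonhole I s (f : nat -> K) : is_ideal I -> covers I s ->
  (forall i, integral (f i)) ->
  exists i j, [/\ (i < j)%N, (j <= size s)%N & I (f j - f i)].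
Proof.
move=> iI [si cs] fi.
have [g gP] : exists g : nat -> K, forall i, g i \in s /\ I (f i - g i).
  have h i : exists r, r \in s /\ I (f i - r) by have [r rs Ir] := cs _ (fi i); exists r.
  by exists (fun i => projT1 (cid (h i))) => i; case: (cid (h i)).
pose t := [seq g i | i <- iota 0 (size s).+1].
have : ~~ uniq t.
  apply/negP => ut; have : (size t <= size s)%N.
    by apply: uniq_leq_size => // _ /mapP[i _ ->]; have [] := gP i.
  by rewrite size_map size_iota ltnn.
move/(uniqPn 0) => [i [j [ij jt e]]].
rewrite size_map size_iota ltnS in jt.
exists i, j; split => //.
move: e; rewrite !(nth_map 0%N) ?size_iota ?ltnS ?(leq_trans (ltnW ij)) //.
rewrite !nth_iota ?ltnS ?(leq_trans (ltnW ij)) // !add0n => e.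
have [_ Ii] := gP i; have [_ Ij] := gP j.
apply: (ideal_sub_trans iI Ij); rewrite -e; exact: ideal_sub_sym.
Qed.

Lemma norm_covers I N : ideal_norm_is I N -> exists2 s, size s = N & covers I s.
Proof.
move=> [s [sz si _ cs]]; exists s => //; split.
  by move=> r /(nthP 0)[i isz <-]; apply: si; rewrite -sz.
by move=> x /cs[i iN Ii]; exists (nth 0 s i) => //; rewrite mem_nth ?sz.
Qed.

Lemma covers_sub I J s : (forall x, I x -> J x) -> covers I s -> covers J s.
Proof. by move=> IJ [si cs]; split=> // x /cs[r rs /IJ]; exists r. Qed.

Lemma norm_le_covers I N s :
  is_ideal I -> ideal_norm_is I N -> covers I s -> (N <= size s)%N.
Proof.
move=> iI [t [sz it dt _]] cs; rewrite leqNgt; apply/negP => lt.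
have fi i : integral (nth 0 t i).
  by case: (ltnP i N) => [/it//|h]; rewrite nth_default ?sz //; exact: integralO0.
have [i [j [ij js Iij]]] := covers_pigeonhole iI cs fi.
have jN := leq_ltn_trans js lt.
have e := dt j i jN (ltn_trans ij jN) Iij.
by rewrite e ltnn in ij.
Qed.

Lemma size_take_drop (s : seq K) i :
  (i < size s)%N -> (size (take i s ++ drop i.+1 s)).+1 = size s.
Proof.
move=> h; rewrite size_cat size_drop (size_takel (ltnW h)) -addnS.
by rewrite -subSn // subSS subnKC // ltnW.
Qed.

Lemma mem_drop_nth (s : seq K) i j :
  (i < j)%N -> (j < size s)%N -> nth 0 s j \in drop i.+1 s.
Proof.
move=> ij js; have -> : nth 0 s j = nth 0 (drop i.+1 s) (j - i.+1).
  by rewrite nth_drop subnKC.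
by apply: mem_nth; rewrite size_drop ltn_sub2r // (leq_ltn_trans ij).
Qed.

(** In a covering list of minimal length no two entries are congruent, since one of them could be
    dropped. *)
Lemma norm_exists_covers I s : is_ideal I -> covers I s ->
  exists N, ideal_norm_is I N.
Proof.
move=> iI cs.
have ex : exists n, `[< exists s, size s = n /\ covers I s >].
  by exists (size s); apply/asboolP; exists s.
case: (ex_minnP ex) => N /asboolP[t [sz [it ct]]] mn; exists N, t; split=> //.
- by move=> i iN; apply: it; rewrite mem_nth ?sz.
- suff H : forall i j, (i < j)%N -> (j < N)%N -> ~ I (nth 0 t i - nth 0 t j).
    move=> i j iN jN Iij; case: (ltngtP i j) => // [ij|ji].
      by case: (H _ _ ij jN).
    by case: (H _ _ ji iN); exact: ideal_sub_sym.
  move=> i j ij jN Iij.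
  pose t' := take j t ++ drop j.+1 t.
  have ht' : (N <= size t')%N.
    apply: mn; apply/asboolP; exists t'; split=> //; split.
      move=> r; rewrite mem_cat => /orP[/mem_take|/mem_drop]; exact: it.
    move=> x /ct[r /(nthP 0)[k kN <-] Ik].
    case: (eqVneq k j) => [e|kj].
      exists (nth 0 t i); last first.
        by apply: ideal_sub_trans Ik _ => //; rewrite e; exact: ideal_sub_sym.
      by rewrite mem_cat -(nth_take _ ij) mem_nth // size_takel // sz ltnW.
    exists (nth 0 t k) => //; rewrite mem_cat.
    case: (ltngtP k j) kj => // [kj|jk] _.
      by rewrite -(nth_take _ kj) mem_nth // size_takel // sz ltnW.
    by rewrite (mem_drop_nth jk) ?orbT.
  by move: ht'; rewrite -sz -(size_take_drop (s := t) (i := j)) ?sz // ltnn.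
- by move=> x /ct[r /(nthP 0)[k kN <-] Ik]; exists k; rewrite -?sz.
Qed.

Lemma norm_lt I J N M w : is_ideal I -> is_ideal J -> (forall x, I x -> J x) ->
  J w -> ~ I w -> ideal_norm_is I N -> ideal_norm_is J M -> (M < N)%N.
Proof.
move=> iI iJ IJ Jw nIw [t [sz it dt ct]] hM.
have [i iN Ii] := ct _ (ideal_int iJ Jw).
have [j jN Ij] := ct _ integralO0.
have ij : j != i.
  apply/eqP => e; apply: nIw; have := idealB iI Ii Ij.
  by rewrite e; congr I; ring.
pose t' := take i t ++ drop i.+1 t.
have ct' : covers J t'.
  split.
    move=> r; rewrite mem_cat => /orP[/mem_take|/mem_drop] /(nthP 0)[k];
      by rewrite sz => kN <-; exact: it.
  move=> x /ct[k kN Ik].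
  have mt' l : (l < N)%N -> l != i -> nth 0 t l \in t'.
    move=> lN li; rewrite mem_cat; case: (ltngtP l i) li => // [kj|jk] _.
      by rewrite -(nth_take _ kj) mem_nth // size_takel // sz ltnW.
    by rewrite (mem_drop_nth jk) ?orbT // sz.
  case: (eqVneq k i) => [e|ki]; last by exists (nth 0 t k); [exact: mt' | exact: IJ].
  exists (nth 0 t j); first exact: mt'.
  have h1 := IJ _ Ik; rewrite e in h1.
  have h2 := IJ _ Ii; have h3 := IJ _ Ij.
  have := idealB iJ (idealD iJ (idealB iJ h1 h2) h3) (idealN iJ Jw).
  by congr J; ring.
have := norm_le_covers iJ hM ct'.
by rewrite -sz -(size_take_drop (s := t) (i := i)) ?sz.
Qed.

Definition princ (a : K) : K -> Prop := fun y => exists2 z, integral z & y = a * z.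

Lemma princ_ideal a : integral a -> is_ideal (princ a).
Proof.
move=> ia; split.
- by move=> _ [z iz ->]; exact: integralM.
- by exists 0; [exact: integralO0 | rewrite mulr0].
- by move=> _ _ [z iz ->] [y iy ->]; exists (z - y); [exact: integralB | ring].
- by move=> r _ ir [z iz ->]; exists (r * z); [exact: integralM | ring].
Qed.

(** For prime [p] this is linear independence in [O / pO] over the field with [p] elements, with
    coefficients kept in [int]. *)
Definition indep_mod (p : nat) k (e : 'I_k -> K) : Prop :=
  forall c : 'I_k -> int, princ p%:R (\sum_i (c i)%:~R * e i) ->
    forall i, (p%:Z %| c i)%Z.

(** Infinite descent: [p] divides every coefficient of a relation, and dividing it out lowers the
    sum of absolute values. *)
Lemma indep_mod_no_relation p k (e : 'I_k -> K) (c : 'I_k -> int) :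
  (1 < p)%N -> indep_mod p e -> \sum_i (c i)%:~R * e i = 0 -> forall i, c i = 0.
Proof.
move=> p1 ie; have [m] := ubnP (\sum_i absz (c i))%N.
elim: m c => // m IH c; rewrite ltnS => cm c0 i.
have dv : forall j, (p%:Z %| c j)%Z.
  by apply: ie; rewrite c0; exists 0; [exact: integralO0 | rewrite mulr0].
pose c' j := (c j %/ p%:Z)%Z.
have ec j : c j = c' j * p%:Z by rewrite /c' divzK.
have c'0 : \sum_j (c' j)%:~R * e j = 0.
  have : (p%:R : K) * \sum_j (c' j)%:~R * e j = 0.
    rewrite -[RHS]c0 mulr_sumr; apply: eq_bigr => j _.
    rewrite [X in _ = X%:~R * _](ec j) intrM.
    by rewrite (_ : p%:Z%:~R = p%:R) //; ring.
  move/eqP; rewrite mulf_eq0 => /orP[|/eqP//].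
  rewrite (_ : p%:R = (p%:Z)%:~R :> K) // intrK_eq0 => /eqP[] p0.
  by rewrite p0 in p1.
case: (eqVneq (c i) 0) => // ci0.
rewrite ec (IH c' _ c'0 i) ?mul0r //.
apply: leq_trans cm.
rewrite [X in (X < _)%N](bigD1 i) //= [X in (_ < X)%N](bigD1 i) //=.
rewrite -addSn leq_add //.
  rewrite [in X in (_ < X)%N]ec abszM ltn_Pmulr // absz_gt0.
  by apply: contraNneq ci0 => e0; rewrite ec e0 mul0r.
apply: leq_sum => j _; rewrite [in X in (_ <= X)%N]ec abszM leq_pmulr //.
by rewrite /= ltnW.
Qed.

Lemma int_multiples k (c : 'I_k -> rat) :
  exists D : int, D != 0 /\ exists c' : 'I_k -> int,
    forall i, (c' i)%:~R = D%:~R * c i.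
Proof.
exists (\prod_i denq (c i)); split.
  by apply/prodf_neq0 => i _; exact: denq_neq0.
exists (fun i => numq (c i) * \prod_(j | j != i) denq (c j)) => i.
rewrite /= intrM numqE [in RHS](bigD1 i) //= intrM; ring.
Qed.

(** Clearing denominators turns a rational relation into an integral one. This bound is behind both
    the finiteness of [O / pO] and the number of primes above [p]. *)
Lemma indep_mod_dim p k (e : 'I_k -> K) :
  (1 < p)%N -> indep_mod p e -> (k <= \dim {:K})%N.
Proof.
move=> p1 ie; pose X := [tuple e i | i < k].
suff /eqP fX : free X.
  by rewrite -(size_tuple X) -fX dimvS // subvf.
apply/freeP => c c0 i.
have [D [D0 [c' ec']]] := int_multiples c.
have : c' i = 0.
  apply: (indep_mod_no_relation p1 ie).
  transitivity (D%:~R *: \sum_(j < k) c j *: X`_j); last by rewrite c0 scaler0.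
  rewrite scaler_sumr; apply: eq_bigr => j _.
  rewrite -tnth_nth tnth_mktuple scalerA -ec' scaler_int mulrC.
  by rewrite mulrzr.
move=> c'0; move: (ec' i); rewrite c'0 => /esym/eqP.
by rewrite mulf_eq0 intr_eq0 (negPf D0) => /eqP.
Qed.
End Ideals.

(** * Finite residue rings, prime ideals and uniformizers *)

Section Primes.
Variable K : fieldExtType rat.
Local Open Scope ring_scope.
Implicit Types (x y z u v w : K) (I P Q : K -> Prop).

(** A maximal family independent modulo [p] exists by [indep_mod_dim]. It spans [O / pO], because
    adjoining [x] creates a relation in which the coefficient of [x] is invertible modulo [p]. *)
Lemma covers_prime p : prime p -> exists s : seq K, covers (princ p%:R) s.
Proof.
move=> pp; have p1 := prime_gt1 pp; have p0 := prime_gt0 pp.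
have iI : is_ideal (princ (p%:R : K)) by apply: princ_ideal; exact: integralOn.
pose A k := `[< exists e : 'I_k -> K, (forall i, integral (e i)) /\ indep_mod p e >].
have exA : exists k, A k.
  by exists 0%N; apply/asboolP; exists (fun=> 0); split=> [|c _] [].
have ubA k : A k -> (k <= \dim {:K})%N.
  by move=> /asboolP[e [_ ie]]; exact: indep_mod_dim ie.
case: (ex_maxnP exA ubA) => k /asboolP[e [e_int ie]] mx.
exists [seq \sum_i (f i : nat)%:R * e i | f : {ffun 'I_k -> 'I_p}]; split.
  move=> r /mapP[f _ ->]; apply: integral_sum_seq => i.
  by apply: integralM => //; exact: integralOn.
move=> x ix.
pose e' (i : 'I_k.+1) := if unlift ord0 i is Some j then e j else x.
have sumE (c : 'I_k.+1 -> int) : \sum_i (c i)%:~R * e' i =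
    (c ord0)%:~R * x + \sum_i (c (lift ord0 i))%:~R * e i.
  rewrite big_ord_recl /e' unlift_none; congr (_ + _).
  by apply: eq_bigr => i _; rewrite liftK.
have : ~ indep_mod p e'.
  move=> ie'; suff : (k.+1 <= k)%N by rewrite ltnn.
  apply: mx; apply/asboolP; exists e'; split=> // i.
  by rewrite /e'; case: unlift.
move/existsNP => [c /not_implyP[pc /existsNP[i0 ni0]]].
rewrite sumE in pc.
have nc0 : ~~ (p%:Z %| c ord0)%Z.
  apply/negP => /dvdzP[c0 ec0].
  have h1 : princ p%:R ((c ord0)%:~R * x).
    exists (c0%:~R * x); first by apply: integralM => //; exact: integral_int.
    by rewrite ec0 intrM (_ : p%:Z%:~R = p%:R) //; ring.
  have := idealB iI pc h1; rewrite addrC addKr => /ie h2.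
  apply: ni0; case: (unliftP ord0 i0) => [j|] -> //.
  by rewrite ec0; apply/dvdzP; exists c0.
have [a [b ab]] : exists a b : int, a * c ord0 = 1 + b * p%:Z.
  have /coprimezP[[u v] /= uv] : coprimez (c ord0) p%:Z.
    rewrite coprimez_sym coprimezE /= prime_coprime //.
  by exists u, (- v); rewrite -uv; ring.
pose g i := (- (a * c (lift ord0 i)) %% p%:Z)%Z.
have g0 i : 0 <= g i by rewrite modz_ge0 // eqz_nat -lt0n.
have gp i : (absz (g i) < p)%N.
  by rewrite -ltz_nat gez0_abs // ltz_pmod.
pose f := [ffun i => Ordinal (gp i)].
exists (\sum_i (f i : nat)%:R * e i); first by apply/mapP; exists f; rewrite ?mem_enum.
have [z iz ez] := pc.
have gE i : exists h : int, (f i : nat)%:R = (- (a * c (lift ord0 i)))%:~R - (h%:~R * p%:R) :> K.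
  exists ((- (a * c (lift ord0 i)) %/ p%:Z)%Z).
  rewrite ffunE /= (_ : (absz (g i))%:R = (g i)%:~R); last first.
    by rewrite -[in RHS](gez0_abs (g0 i)).
  by rewrite /g /modz intrB intrM.
pose h i := projT1 (cid (gE i)).
have hE i : (f i : nat)%:R = (- (a * c (lift ord0 i)))%:~R - ((h i)%:~R * p%:R) :> K.
  by rewrite /h; case: cid.
(* [a] inverts the coefficient of [x] modulo [p]. The solved coefficients are reduced below [p], and
   the quotients [h] are absorbed into the multiple of [p]. *)
exists (a%:~R * z - b%:~R * x + \sum_i (h i)%:~R * e i).
  apply: integralD; first by apply: integralB; apply: integralM => //; exact: integral_int.
  by apply: integral_sum_seq => i; apply: integralM => //; exact: integral_int.
under eq_bigr do rewrite hE mulrBl.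
rewrite sumrB mulrDr.
have -> : \sum_i (h i)%:~R * p%:R * e i = p%:R * \sum_i (h i)%:~R * e i.
  by rewrite mulr_sumr; apply: eq_bigr => i _; ring.
have -> : \sum_(i < k) (- (a * c (lift ord0 i)))%:~R * e i =
   - (a%:~R * \sum_i (c (lift ord0 i))%:~R * e i).
  rewrite mulr_sumr -sumrN; apply: eq_bigr => i _.
  by rewrite mulrNz intrM; ring.
have E1 : a%:~R * (c ord0)%:~R = 1 + b%:~R * p%:R :> K.
  by rewrite -intrM ab intrD intrM.
have E2 : p%:R * (a%:~R * z) = a%:~R * (c ord0)%:~R * x +
    a%:~R * \sum_i (c (lift ord0 i))%:~R * e i.
  by rewrite mulrCA -ez; ring.
rewrite mulrBr E2 E1; ring.
Qed.

Lemma covers_nat n : (0 < n)%N -> exists s : seq K, covers (princ n%:R) s.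
Proof.
have [m] := ubnP n; elim: m n => // m IH n; rewrite ltnS => nm n0.
case: (leqP n 1) => n1.
  have -> : n = 1%N by apply/eqP; rewrite eqn_leq n1.
  exists [:: 0]; split=> [r|x ix].
    by rewrite inE => /eqP ->; exact: integralO0.
  by exists 0; rewrite ?inE //; exists x => //; rewrite subr0 mul1r.
have pp := pdiv_prime n1; set p := pdiv n in pp.
have en : n = (p * (n %/ p))%N by rewrite mulnC divnK // pdiv_dvd.
set k := (n %/ p)%N in en.
have k0 : (0 < k)%N by move: n0; rewrite en muln_gt0 => /andP[].
have kn : (k < n)%N by rewrite /k ltn_Pdiv // prime_gt1.
have [s [s_int cs]] := IH k (leq_trans kn nm) k0.
have [t [t_int ct]] := covers_prime pp.
exists [seq r + p%:R * r' | r <- t, r' <- s]; split.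
  move=> _ /allpairsP[[r r'] /= [rt rs ->]].
  apply: integralD; first exact: t_int.
  by apply: integralM; [exact: integralOn | exact: s_int].
move=> x /ct[r rt [y iy ey]]; have [r' rs [z iz ez]] := cs _ iy.
exists (r + p%:R * r'); first by apply/allpairsP; exists (r, r').
by exists z => //; rewrite opprD addrA ey -mulrBr ez en natrM; ring.
Qed.

Lemma covers_exists I : nonzero_ideal I -> exists s, covers I s.
Proof.
move=> nI; have [n n0 In] := nonzero_ideal_nat nI.
have [s cs] := covers_nat n0; exists s; apply: covers_sub cs => _ [z iz ->].
by apply: idealMr => //; case: nI.
Qed.

Lemma norm_exists I : nonzero_ideal I -> exists N, ideal_norm_is I N.
Proof.
move=> nI; have [s cs] := covers_exists nI.
by apply: norm_exists_covers cs; case: nI.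
Qed.

Lemma nonzero_ideal_sub I Q : nonzero_ideal I -> is_ideal Q ->
  (forall x, I x -> Q x) -> nonzero_ideal Q.
Proof. by move=> [_ [x [Ix x0]]] iQ IQ; split=> //; exists x; split=> //; exact: IQ. Qed.

Definition add_princ I (a : K) : K -> Prop :=
  fun y => exists x z, [/\ I x, integral z & y = x + a * z].

Lemma add_princ_ideal I a : is_ideal I -> integral a -> is_ideal (add_princ I a).
Proof.
move=> iI ia; split.
- move=> _ [x [z [Ix iz ->]]]; apply: integralD; [exact: ideal_int Ix | exact: integralM].
- by exists 0, 0; split; [exact: ideal0 | exact: integralO0 | rewrite mulr0 addr0].
- move=> _ _ [x [z [Ix iz ->]]] [x' [z' [Ix' iz' ->]]].
  exists (x - x'), (z - z'); split; [exact: idealB | exact: integralB | ring].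
- move=> r _ ir [x [z [Ix iz ->]]]; exists (r * x), (r * z).
  split; [exact: idealMl | exact: integralM | ring].
Qed.

Lemma add_princ_l I a x : I x -> add_princ I a x.
Proof. by move=> Ix; exists x, 0; split=> //; [exact: integralO0 | rewrite mulr0 addr0]. Qed.

Lemma add_princ_r I a : is_ideal I -> add_princ I a a.
Proof.
move=> iI; exists 0, 1; split; [exact: ideal0 | exact: integralO1 | by rewrite mulr1 add0r].
Qed.

Lemma prime_nonmem_pow P a n : prime_ideal P -> integral a -> ~ P a -> ~ P (a ^+ n).
Proof.
move=> [_ P1 pP] ia na; elim: n => // n IH; rewrite exprS => /pP h.
by case: (h ia (integralX n ia)).
Qed.

Lemma prime_nonmemM P a b : prime_ideal P -> integral a -> integral b ->
  ~ P a -> ~ P b -> ~ P (a * b).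
Proof. by move=> [_ _ pP] ia ib na nb /pP h; case: (h ia ib). Qed.

(** Pigeonhole on the powers of [a]. Where [a ^ i] can be cancelled modulo [I], some positive power
    of [a] is [1] modulo [I]. *)
Lemma pow_congr I a : nonzero_ideal I -> integral a ->
  exists i k : nat, (0 < k)%N /\ I (a ^+ i * (a ^+ k - 1)).
Proof.
move=> nI ia; have [s cs] := covers_exists nI; have [iI _] := nI.
have [i [j [ij _ h]]] := covers_pigeonhole iI cs (fun i => integralX i ia).
exists i, (j - i)%N; rewrite subn_gt0 ij; split=> //.
by rewrite mulrBr -exprD subnKC ?mulr1 // ltnW.
Qed.

Lemma prime_inv P a : prime_ideal P -> nonzero_ideal P -> integral a -> ~ P a ->
  exists2 b, integral b & P (a * b - 1).
Proof.
move=> pP nP ia na; have [i [k [k0 h]]] := pow_congr nP ia.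
exists (a ^+ k.-1); first exact: integralX.
rewrite -exprS prednK //; case: pP (pP) => _ _ /(_ _ _ _ _ h) + pP.
case=> //; first exact: integralX.
- by apply: integralB; [exact: integralX | exact: integralO1].
- by move/prime_nonmem_pow; case.
Qed.

Lemma prime_maximal P Q : prime_ideal P -> nonzero_ideal P -> is_ideal Q -> ~ Q 1 ->
  (forall x, P x -> Q x) -> same_set P Q.
Proof.
move=> pP nP iQ nQ1 PQ x; split; first exact: PQ.
move=> Qx; apply: contrapT => nPx.
have [b ib h] := prime_inv pP nP (ideal_int iQ Qx) nPx.
apply: nQ1; have := idealB iQ (idealMr iQ Qx ib) (PQ _ h); congr Q; ring.
Qed.

(** Noetherian induction: passing to a strictly larger ideal lowers the norm, by [norm_lt]. *)
Lemma norm_ind (Pr : (K -> Prop) -> Prop) :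
  (forall I, nonzero_ideal I ->
     (forall Q w, nonzero_ideal Q -> (forall x, I x -> Q x) -> Q w -> ~ I w -> Pr Q) -> Pr I) ->
  forall I, nonzero_ideal I -> Pr I.
Proof.
move=> H I nI; have [N hN] := norm_exists nI.
have [m] := ubnP N; elim: m I N nI hN => // m IH I N nI hN; rewrite ltnS => Nm.
apply: H => // Q w nQ IQ Qw nIw; have [M hM] := norm_exists nQ.
apply: (IH Q M) => //; apply: leq_trans Nm.
by case: nI nQ => iI _ [iQ _]; exact: norm_lt Qw nIw hN hM.
Qed.

Lemma proper_in_prime I : nonzero_ideal I -> ~ I 1 -> exists P, prime_factor I P.
Proof.
move: I; apply: norm_ind => I nI IH nI1; have [iI _] := nI.
case: (pselect (prime_ideal I)) => [pI|]; first by exists I.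
move=> npI.
have [Q [w [nQ IQ [Qw nIw] Q1]]] : exists Q w, [/\ nonzero_ideal Q,
    (forall x, I x -> Q x), Q w /\ ~ I w & ~ Q 1].
  apply: contrapT => H; apply: npI; split=> // a b ia ib Iab.
  apply: contrapT => /not_orP[nIa nIb].
  have iA := add_princ_ideal iI ia.
  have nA : nonzero_ideal (add_princ I a).
    by apply: nonzero_ideal_sub nI iA _ => x; exact: add_princ_l.
  (* If [I + (a)] contained 1, multiplying [1 = x + a * z] by [b] would put [b] into [I]. *)
  case: (pselect (add_princ I a 1)) => [[x [z [Ix iz e]]]|nA1].
    apply: nIb; rewrite -(mulr1 b) e mulrDr.
    apply: idealD => //; first exact: idealMl.
    by rewrite mulrA (mulrC b); apply: idealMr.
  apply: H; exists (add_princ I a), a; split=> //; first by move=> x; exact: add_princ_l.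
  by split=> //; exact: add_princ_r.
have [P [pP QP]] := IH Q w nQ IQ Qw nIw Q1.
by exists P; split=> // x /IQ/QP.
Qed.

Definition colon I (a : K) : K -> Prop := fun y => integral y /\ I (a * y).

Lemma colon_ideal I a : is_ideal I -> is_ideal (colon I a).
Proof.
move=> iI; split.
- by move=> x [].
- by split; [exact: integralO0 | rewrite mulr0; exact: ideal0].
- move=> x y [ix Ix] [iy Iy]; split; first exact: integralB.
  by rewrite mulrBr; exact: idealB.
- move=> r x ir [ix Ix]; split; first exact: integralM.
  by rewrite mulrCA; exact: idealMl.
Qed.

Lemma colon_sub I a x : is_ideal I -> integral a -> I x -> colon I a x.
Proof. by move=> iI ia Ix; split; [exact: ideal_int Ix | exact: idealMl]. Qed.

(* P is associated to I: a maximal one among the ideals (I : b) contained in P is P. *)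
Lemma prime_associated P I : prime_ideal P -> nonzero_ideal I ->
  (forall x, I x -> P x) ->
  exists b, [/\ integral b, ~ I b & forall y, P y -> I (b * y)].
Proof.
move=> pP; move: I; apply: norm_ind => I nI IH IP; have [iI _] := nI.
have [iP P1 pP'] := pP.
have step c w : integral c -> colon I c w -> ~ I w -> (forall x, colon I c x -> P x) ->
    exists b, [/\ integral b, ~ I b & forall y, P y -> I (b * y)].
  move=> ic cw nIw cP.
  have nQ : nonzero_ideal (colon I c).
    by apply: nonzero_ideal_sub nI (colon_ideal _ iI) _ => x; exact: colon_sub.
  have [b [ib nb hb]] := IH _ w nQ (fun x => @colon_sub I c x iI ic) cw nIw cP.
  exists (c * b); split; first exact: integralM.
    by move=> h; apply: nb.
  by move=> y /hb[_]; rewrite mulrA.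
(* If [r] in [P] is not nilpotent modulo [I], then [r ^ k - 1] lies outside [P], so
   [colon I (r ^ k - 1)] stays inside [P] and gains [r ^ i]. *)
case: (pselect (exists2 r, P r & forall n, ~ I (r ^+ n))) => [[r Pr nr]|].
  have ir := ideal_int iP Pr.
  have [i [k [k0 h]]] := pow_congr nI ir.
  have nPe : ~ P (r ^+ k - 1).
    move=> h'; apply: P1; have := idealB iP (idealMr iP Pr (integralX k.-1 ir)) h'.
    by rewrite -exprS prednK // subKr.
  have ie : integral (r ^+ k - 1) by apply: integralB; [exact: integralX | exact: integralO1].
  apply: (step (r ^+ k - 1) (r ^+ i)) => //.
    by split; [exact: integralX | rewrite mulrC].
  by move=> x [ix /IP/pP'] [].
move/forall2NP => nil.
have {}nil r : P r -> exists n, I (r ^+ n).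
  by move=> Pr; case: (nil r) => // /existsNP[n /contrapT]; exists n.
(* Now all of [P] is nilpotent modulo [I]. Unless [P] lies in [I], take [r ^ n] to be the last power
   outside [I]; then [colon I (r ^ n)] gains [r]. *)
case: (pselect (exists2 r, P r & ~ I r)) => [[r Pr nIr]|]; last first.
  move/forall2NP => H; exists 1; split; [exact: integralO1 | by move/IP |].
  by move=> y Py; rewrite mul1r; case: (H y) => // /contrapT.
have ir := ideal_int iP Pr.
have ex : exists n, `[< I (r ^+ n) >] by have [n ?] := nil r Pr; exists n; apply/asboolP.
case: (ex_minnP ex) => -[/asboolP/IP//|n] /asboolP In mn.
have ns : ~ I (r ^+ n) by move=> /asboolP/mn; rewrite ltnn.
apply: (step (r ^+ n) r); [exact: integralX | | by [] | ].
  by split=> //; rewrite -exprSr.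
move=> u [iu Iu]; apply: contrapT => nPu.
have nP : nonzero_ideal P by exact: nonzero_ideal_sub nI iP IP.
have [v iv huv] := prime_inv pP nP iu nPu.
have [m Im] := nil _ huv.
have Iuv : I (r ^+ n * (u * v)) by rewrite mulrA; exact: idealMr.
apply: ns.
(* Up to a multiple of [u * v], the power [(u * v - 1) ^ m] is a sign. Multiplied by [r ^ n], both
   the power and that multiple lie in [I], hence so does [r ^ n]. *)
have [w iw ew] : exists2 w, integral w & (u * v - 1) ^+ m = u * v * w + (- 1) ^+ m.
  have iuv : integral (u * v - 1) by exact: ideal_int huv.
  elim: m {Im} => [|m [w iw ew]]; first by exists 0; [exact: integralO0 | rewrite mulr0 add0r].
  exists ((u * v - 1) ^+ m - w); first by apply: integralB => //; exact: integralX.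
  by rewrite [in LHS]exprS mulrBl mul1r [X in _ - X]ew exprS; ring.
have h1 : I (r ^+ n * (u * v * w)) by rewrite mulrA; exact: idealMr.
have := idealB iI (idealMl iI (integralX n ir) Im) h1.
rewrite -mulrBr ew addrC addKr => h2.
have := idealMr iI h2 (integralX m (integralN (integralO1 K))).
by rewrite -mulrA -exprMn mulrN1 opprK expr1n mulr1.
Qed.

(** Up to the factor [u], a unit at [P], the prime is generated by [t]. For nonzero [a] in [P],
    [prime_associated] yields [x = b / a] outside [O] with [x P] inside [O]. If [x P] were inside
    [P], all [a * x ^ n] would be integral, and pigeonhole modulo [a] would make [x] integral. So
    some [u = x * t] avoids [P], and [u * y = t * (x * y)]. *)
Lemma uniformizer P : prime_ideal P -> nonzero_ideal P ->
  exists t u, [/\ P t, t != 0, integral u, ~ P u & forall y, P y -> princ t (u * y)].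
Proof.
move=> pP nP; have [iP [a [Pa a0]]] := nP.
have ia := ideal_int iP Pa.
have ip := princ_ideal ia.
have np : nonzero_ideal (princ a).
  split=> //; exists a; split=> //.
  by exists 1; [exact: integralO1 | rewrite mulr1].
have [b [ib nb hb]] : exists b, [/\ integral b, ~ princ a b & forall y, P y -> princ a (b * y)].
  by apply: prime_associated => // _ [z iz ->]; exact: idealMr.
pose x := b / a.
have xP y : P y -> integral (x * y).
  by move=> /hb[z iz e]; rewrite /x mulrAC e mulrAC divff // mul1r.
have nx : ~ integral x.
  by move=> ix; apply: nb; exists x => //; rewrite /x mulrC divfK.
have [t Pt nt] : exists2 t, P t & ~ P (x * t).
  apply: contrapT => /forall2NP H; apply: nx.
  have {}H y : P y -> P (x * y) by move=> Py; case: (H y) => // /contrapT.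
  have Pn n : P (a * x ^+ n).
    elim: n => [|n IH]; first by rewrite mulr1.
    by rewrite exprS mulrCA; exact: H.
  have [s cs] := covers_exists np.
  have [i [j [ij _ [z iz e]]]] := covers_pigeonhole ip cs (fun n => ideal_int iP (Pn n)).
  apply: (integral_pow_root ij iz); apply: (mulfI a0); rewrite -e; ring.
exists t, (x * t); split=> //.
- by apply: contra_notN nt => /eqP ->; rewrite mulr0; exact: ideal0.
- exact: xP.
- by move=> y Py; exists (x * y); [exact: xP | ring].
Qed.
End Primes.

(** * Powers of a prime ideal through localization *)

Section LocalPowers.
Variable K : fieldExtType rat.
Local Open Scope ring_scope.
Implicit Types (x y z u v w : K) (I P Q : K -> Prop).

(* The contraction to O of the k-th power of the maximal ideal of the localization at P,
   t being a uniformizer; in fact the ideal power P^k. *)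
Definition dpow P (t : K) (k : nat) : K -> Prop :=
  fun z => integral z /\ exists u, [/\ integral u, ~ P u & princ (t ^+ k) (u * z)].

Variables (P : K -> Prop) (t u0 : K).
Hypotheses (pP : prime_ideal P) (nP : nonzero_ideal P).
Hypotheses (Pt : P t) (t0 : t != 0) (iu0 : integral u0) (nPu0 : ~ P u0).
Hypothesis uP : forall y, P y -> princ t (u0 * y).

Let iP : is_ideal P. Proof. by case: nP. Qed.
Let it : integral t. Proof. exact: ideal_int Pt. Qed.
Local Notation D := (dpow P t).

Lemma dpow_ideal k : is_ideal (D k).
Proof.
split.
- by move=> x [].
- split; first exact: integralO0.
  exists 1; split; [exact: integralO1 | by case: pP |].
  by rewrite mulr0; apply: ideal0; apply: princ_ideal; exact: integralX.
- move=> x y [ix [u [iu nu [x' ix' ex]]]] [iy [v [iv nv [y' iy' ey]]]].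
  split; first exact: integralB.
  exists (u * v); split; [exact: integralM | exact: prime_nonmemM |].
  exists (v * x' - u * y'); first by apply: integralB; exact: integralM.
  by rewrite [RHS]mulrBr mulrCA -ex [X in _ = _ - X]mulrCA -ey; ring.
- move=> r x ir [ix [u [iu nu [x' ix' ex]]]]; split; first exact: integralM.
  exists u; split=> //; exists (r * x'); first exact: integralM.
  by rewrite mulrCA ex; ring.
Qed.

Lemma dpow0 z : integral z -> D 0 z.
Proof.
move=> iz; split=> //; exists 1; split; [exact: integralO1 | by case: pP |].
by exists z => //; rewrite expr0.
Qed.

Lemma dpow_sat k u z : integral u -> ~ P u -> integral z -> D k (u * z) -> D k z.
Proof.
move=> iu nu iz [_ [v [iv nv h]]]; split=> //; exists (v * u).
by split; [exact: integralM | exact: prime_nonmemM | rewrite -mulrA].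
Qed.

Lemma dpow_sub k l z : (k <= l)%N -> D l z -> D k z.
Proof.
move=> kl [iz [v [iv nv [y iy e]]]]; split=> //; exists v; split=> //.
exists (t ^+ (l - k) * y); first by apply: integralM => //; exact: integralX.
by rewrite mulrA -exprD subnKC.
Qed.

Lemma dpow_t k z : integral z -> D k (t ^+ k * z).
Proof.
move=> iz; split; first by apply: integralM => //; exact: integralX.
exists 1; split; [exact: integralO1 | by case: pP |].
by exists z => //; rewrite mul1r.
Qed.

(** Multiplication by [t ^ k] thus embeds [O / P] into [D k / D k.+1]; by [dpow_gen] it is onto. *)
Lemma dpow_tS k z : integral z -> D k.+1 (t ^+ k * z) <-> P z.
Proof.
move=> iz; split.
  move=> [_ [v [iv nv [y iy e]]]].
  have {}e : v * z = t * y.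
    by apply: (mulfI (expf_neq0 k t0)); rewrite mulrCA e exprSr mulrA.
  have : P (v * z) by rewrite e; exact: idealMr.
  by case: pP => _ _ h /h[].
move=> Pz; split; first by apply: integralM => //; exact: integralX.
have [y iy e] := uP Pz.
exists u0; split=> //; exists y => //.
by rewrite mulrCA e exprSr mulrA.
Qed.

Lemma dpow_mul k y z : P y -> D k z -> D k.+1 (y * z).
Proof.
move=> Py [iz [v [iv nv [w iw e]]]]; split; first by apply: integralM => //; exact: ideal_int Py.
have [y' iy' ey] := uP Py.
exists (u0 * v); split; [exact: integralM | exact: prime_nonmemM |].
exists (y' * w); first exact: integralM.
by rewrite mulrACA e ey exprSr; ring.
Qed.

Lemma dpow_exp k y : P y -> D k (y ^+ k).
Proof.
move=> Py; elim: k => [|k IH]; first exact/dpow0/integralO1.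
by rewrite exprS; exact: dpow_mul.
Qed.

Lemma dpow_nonzero k : nonzero_ideal (D k).
Proof.
split; first exact: dpow_ideal.
exists (t ^+ k); split; last exact: expf_neq0.
by rewrite -(mulr1 (t ^+ k)); apply/dpow_t/integralO1.
Qed.

Lemma dpow_gen k z : D k z -> exists2 y, integral y & D k.+1 (z - t ^+ k * y).
Proof.
move=> Dz; have [iz [u [iu nu [y iy e]]]] := Dz.
have [v iv huv] := prime_inv pP nP iu nu.
exists (v * y); first exact: integralM.
have -> : z - t ^+ k * (v * y) = - ((u * v - 1) * z).
  by rewrite mulrCA -e; ring.
by apply: idealN; [exact: dpow_ideal | exact: dpow_mul].
Qed.

(** This bounds the exponent of [P] in [I]. If [t ^ i] and [t ^ j] agree modulo [I], then
    [t ^ (j - i) - 1] is a unit at [P], and [I] inside [D i.+1] would force [t ^ i] into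
    [D i.+1]. *)
Lemma dpow_not_all I s k : is_ideal I -> covers I s -> (forall x, I x -> D k x) ->
  (k <= size s)%N.
Proof.
move=> iI cs ID; rewrite leqNgt; apply/negP => sk.
have [i [j [ij js h]]] := covers_pigeonhole iI cs (fun i => integralX i it).
have {}h : D i.+1 ((t ^+ (j - i) - 1) * (t ^+ i * 1)).
  apply: (@dpow_sub _ k); first by apply: leq_ltn_trans sk; apply: leq_trans (ltnW ij) js.
  by rewrite mulr1 mulrBl -exprD subnK ?mul1r; [exact: ID | exact: ltnW].
have P1 : ~ P 1 by case: pP.
apply: P1; apply/(@dpow_tS i); first exact: integralO1.
apply: dpow_sat h.
- by apply: integralB; [exact: integralX | exact: integralO1].
- have ji : (0 < j - i)%N by rewrite subn_gt0.
  rewrite -(prednK ji) exprS => h; case: (pP) => _ P1 _; apply: P1.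
  by have := idealB iP (idealMr iP Pt (integralX (j - i).-1 it)) h; rewrite subKr.
- by apply: integralM; [exact: integralX | exact: integralO1].
Qed.

Lemma ideal_local I : nonzero_ideal I -> exists k,
  (forall z, I z -> D k z) /\
  (forall z, D k z -> exists u, [/\ integral u, ~ P u & I (u * z)]).
Proof.
move=> nI; have [iI _] := nI; have [s cs] := covers_exists nI.
pose A k := `[< forall x, I x -> D k x >].
have exA : exists k, A k.
  by exists 0%N; apply/asboolP => x Ix; apply/dpow0/(ideal_int iI).
have ubA k : A k -> (k <= size s)%N by move=> /asboolP; exact: dpow_not_all.
case: (ex_maxnP exA ubA) => k /asboolP Ik mx; exists k; split=> // w [iw [v [iv nv [w' iw' ew]]]].
have [y Iy ny] : exists2 y, I y & ~ D k.+1 y.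
  apply: contrapT => /forall2NP H; suff : (k.+1 <= k)%N by rewrite ltnn.
  by apply: mx; apply/asboolP => x Ix; case: (H x) => // /contrapT.
have [iy [u [iu nu [z iz ez]]]] := Ik _ Iy.
have nz : ~ P z.
  move=> Pz; apply: ny; apply: (@dpow_sat _ u) => //; rewrite ez.
  by apply/dpow_tS.
exists (z * v); split; [exact: integralM | exact: prime_nonmemM |].
rewrite -mulrA ew mulrCA mulrA -ez -mulrA; apply: idealMl => //.
by apply: idealMr.
Qed.

(** Expansions in base [t]: if [rs] represents [O / P], they represent [O] modulo [D e]. *)
Fixpoint digits (rs : seq K) (e : nat) : seq K :=
  if e is e'.+1 then [seq x + t ^+ e' * r | x <- digits rs e', r <- rs] else [:: 0].

Lemma size_digits rs e : size (digits rs e) = (size rs ^ e)%N.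
Proof. by elim: e => //= e IH; rewrite size_allpairs IH expnSr. Qed.

Lemma digits_covers rs e : covers P rs -> covers (D e) (digits rs e).
Proof.
move=> [rs_int crs]; elim: e => [|e [IHi IHc]] /=.
  split=> [r|x ix]; first by rewrite inE => /eqP->; exact: integralO0.
  by exists 0; rewrite ?inE // subr0; exact: dpow0.
split.
  move=> _ /allpairsP[[x r] /= [/IHi ix /rs_int ir ->]].
  by apply: integralD => //; apply: integralM => //; exact: integralX.
move=> x /IHc[d ds /dpow_gen[y iy h]]; have [r rr Pr] := crs _ iy.
exists (d + t ^+ e * r); first by apply/allpairsP; exists (d, r).
have iyr : integral (y - r) by exact: ideal_int Pr.
have := idealD (dpow_ideal e.+1) h (proj2 (dpow_tS e iyr) Pr).
by congr D; ring.
Qed.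

Lemma count_le1 (p : pred K) (s : seq K) :
  (forall i j, (i < size s)%N -> (j < size s)%N ->
     p (nth 0 s i) -> p (nth 0 s j) -> i = j) -> (count p s <= 1)%N.
Proof.
elim: s => //= x s IH H.
have IHs : (count p s <= 1)%N.
  by apply: IH => i j ii jj pi pj; have [] := H i.+1 j.+1 ii jj pi pj.
case px: (p x) => //=; rewrite add1n ltnS leqn0 -leqn0 leqNgt -has_count.
apply/negP => /(has_nthP 0)[i ii pi].
by have := H 0%N i.+1 isT ii px pi.
Qed.

(** A residue modulo [D k] determines the lowest [k] digits and leaves [e - k] free. The induction
    removes the top digit, which is determined when [k] is the full length and free otherwise. *)
Lemma digits_count rs e k a :
  (forall r, r \in rs -> integral r) ->
  (forall i j, (i < size rs)%N -> (j < size rs)%N ->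
     P (nth 0 rs i - nth 0 rs j) -> i = j) ->
  (k <= e)%N ->
  (count (fun x => `[< D k (x - a) >]) (digits rs e) <= size rs ^ (e - k))%N.
Proof.
move=> rs_int rs_d; elim: e k => [|e IH] k /=.
  by rewrite leqn0 => /eqP ->; rewrite addn0 leq_b1.
have cE k' : count (fun x => `[< D k' (x - a) >])
    [seq x + t ^+ e * r | x <- digits rs e, r <- rs] =
  (\sum_(x <- digits rs e) count (fun r => `[< D k' (x + t ^+ e * r - a) >]) rs)%N.
  rewrite count_flatten sumnE !big_map; apply: eq_bigr => x _.
  by rewrite count_map.
rewrite leq_eqVlt ltnS => /orP[/eqP ->|ke].
  have := IH e (leqnn e); rewrite cE !subnn !expn0; apply: leq_trans.
  rewrite -sum1_count [X in (_ <= X)%N]big_mkcond /=.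
  rewrite big_seq [X in (_ <= X)%N]big_seq.
  apply: leq_sum => x xs; case: ifPn => [|/asboolPn nx].
    move=> /asboolP Dx; apply: count_le1 => i j ii jj /asboolP h1 /asboolP h2.
    apply: rs_d => //.
    have ir : integral (nth 0 rs i - nth 0 rs j).
      by apply: integralB; apply: rs_int; rewrite mem_nth.
    apply/(dpow_tS e ir); have := idealB (dpow_ideal e.+1) h1 h2.
    by congr D; ring.
  rewrite leqn0 -leqn0 leqNgt -has_count; apply/hasPn => r rr.
  apply/asboolPn => h; apply: nx.
  have := idealB (dpow_ideal e) (dpow_sub (leqnSn e) h) (dpow_t e (rs_int _ rr)).
  by congr D; ring.
rewrite cE subSn // expnS mulnC.
apply: leq_trans (leq_mul (IH k ke) (leqnn (size rs))).
rewrite -sum1_count big_distrl /= [X in (_ <= X)%N]big_mkcond /=.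
apply: leq_sum => x _.
case: ifPn => [_|/asboolPn nx]; first by rewrite mul1n count_size.
rewrite leqn0 -leqn0 leqNgt -has_count; apply/hasPn => r rr.
apply/asboolPn => h; apply: nx.
have := idealB (dpow_ideal k) h (dpow_sub ke (dpow_t e (rs_int _ rr))).
by congr D; ring.
Qed.
End LocalPowers.

(** * Finitely many primes and the Chinese remainder theorem *)

Section FinitelyManyPrimes.
Variable K : fieldExtType rat.
Local Open Scope ring_scope.
Implicit Types (x y z u v w : K) (I P Q : K -> Prop).

Definition distinct_primes L (Ps : 'I_L -> K -> Prop) : Prop :=
  [/\ forall i, prime_ideal (Ps i), forall i, nonzero_ideal (Ps i)
    & forall i j, same_set (Ps i) (Ps j) -> i = j].

Lemma distinct_primes_sub L M (Ps : 'I_L -> K -> Prop) (f : 'I_M -> 'I_L) :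
  injective f -> distinct_primes Ps -> distinct_primes (fun i => Ps (f i)).
Proof. by move=> fi [h1 h2 h3]; split=> // i j /h3/fi. Qed.

(** By maximality there is [w (i, j)] in [Ps j] but not in [Ps i]; since [Ps i] is prime, the
    product over [j] stays outside it. *)
Lemma separating L (Ps : 'I_L -> K -> Prop) : distinct_primes Ps ->
  exists e : 'I_L -> K, [/\ forall i, integral (e i), forall i, ~ Ps i (e i)
    & forall i j, j != i -> Ps j (e i)].
Proof.
move=> [pPs nPs dPs].
have h (ij : 'I_L * 'I_L) : exists w, ij.2 != ij.1 -> Ps ij.2 w /\ ~ Ps ij.1 w.
  case: (eqVneq ij.2 ij.1) => [_|/eqP ne]; first by exists 0.
  apply: contrapT => /forallNP H; apply/ne/dPs/prime_maximal => //.
  - by case: (nPs ij.1).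
  - by case: (pPs ij.1).
  - move=> x Px; apply: contrapT => nx; exact: (H x).
have [w wP] := choice h.
exists (fun i => \prod_(j | j != i) w (i, j)).
have wi i j : j != i -> integral (w (i, j)).
  by move=> /(wP (i, j))[/= Pj _]; case: (nPs j) => iP _; exact: ideal_int Pj.
have H i : integral (\prod_(j | j != i) w (i, j)) /\ ~ Ps i (\prod_(j | j != i) w (i, j)).
  apply: (big_ind (fun x => integral x /\ ~ Ps i x)).
  - by split; [exact: integralO1 | case: (pPs i)].
  - by move=> x y [ix nx] [iy ny]; split; [exact: integralM | exact: prime_nonmemM].
  - by move=> j ji; split; [exact: wi | case: (wP (i, j) ji)].
split=> [i|i|i j ji]; [by case: (H i) | by case: (H i) |].
rewrite (bigD1 j) //=; case: (nPs j) => iP _; apply: idealMr => //.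
  by case: (wP (i, j) ji).
apply: (big_ind (@integral K)); [exact: integralO1 | exact: integralM |].
by move=> l /andP[li _]; exact: wi.
Qed.

Lemma prime_ideal_int_dvd P p (c : int) : prime_ideal P -> prime p -> P p%:R ->
  P c%:~R -> (p%:Z %| c)%Z.
Proof.
move=> [iP P1 _] pp Pp Pc; apply: contrapT => /negP nd.
have /coprimezP[[u v] /= uv] : coprimez c p%:Z.
  by rewrite coprimez_sym coprimezE /= prime_coprime.
apply: P1; have <- : u%:~R * c%:~R + v%:~R * p%:R = 1 :> K.
  by rewrite -intrM (_ : p%:R = p%:Z%:~R) // -intrM -intrD uv.
by apply: idealD => //; apply: idealMl => //; exact: integral_int.
Qed.

(** Separating elements are independent modulo [p]: modulo [Ps i] a relation reduces to its [i]-th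
    term, and an integer in [Ps i] is divisible by [p]. *)
Lemma primes_above L (Ps : 'I_L -> K -> Prop) p : distinct_primes Ps -> prime p ->
  (forall i, Ps i p%:R) -> (L <= \dim {:K})%N.
Proof.
move=> dPs pp Pp; have [e [ei ne Pe]] := separating dPs; have [pPs nPs _] := dPs.
apply: (indep_mod_dim (prime_gt1 pp) (e := e)) => c [y iy hc] i.
have [iP _] := nPs i.
have h1 : Ps i (\sum_j (c j)%:~R * e j) by rewrite hc; exact: idealMr.
have h2 : Ps i (\sum_(j | j != i) (c j)%:~R * e j).
  apply: ideal_sum_seq => // j ji; apply: idealMl => //; first exact: integral_int.
  by apply: Pe; rewrite eq_sym.
have := idealB iP h1 h2; rewrite (bigD1 i) //= addrK => h3.
apply: (prime_ideal_int_dvd (pPs i) pp (Pp i)).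
by case: (pPs i) => _ _ /(_ _ _ (integral_int _ _) (ei i) h3)[|/ne].
Qed.

Lemma distinct_primes_bound L (Ps : 'I_L -> K -> Prop) I s : distinct_primes Ps ->
  is_ideal I -> (forall i x, I x -> Ps i x) -> covers I s -> (L <= size s)%N.
Proof.
move=> dPs iI IPs cs; have [e [ei ne Pe]] := separating dPs; have [_ nPs _] := dPs.
rewrite leqNgt; apply/negP => sL.
pose f i := if insub i is Some o then e o else 0.
have fi i : integral (f i) by rewrite /f; case: insub => [o|]; [exact: ei | exact: integralO0].
have [i [j [ij js]]] := covers_pigeonhole iI cs fi.
have jL := leq_ltn_trans js sL; have iL := ltn_trans ij jL.
rewrite /f !insubT /= => h.
have [iP _] := nPs (Ordinal jL).
apply: (ne (Ordinal jL)); rewrite -[e _](subrK (e (Ordinal iL))).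
by apply: idealD => //; [exact: IPs | apply: Pe; rewrite -val_eqE /= gtn_eqF].
Qed.

Lemma all_primes I : nonzero_ideal I -> exists L (Ps : 'I_L -> K -> Prop),
  distinct_primes Ps /\ forall Q, prime_factor I Q -> exists i, same_set Q (Ps i).
Proof.
move=> nI; have [iI _] := nI; have [s cs] := covers_exists nI.
pose A L := `[< exists Ps : 'I_L -> K -> Prop, distinct_primes Ps /\ forall i x, I x -> Ps i x >].
have exA : exists k, A k.
  exists 0%N; apply/asboolP; exists (fun _ _ => False); split; last by case=> [[]].
  by split; case=> [[]].
have ubA L : A L -> (L <= size s)%N.
  by move=> /asboolP[Ps [dPs IPs]]; exact: (distinct_primes_bound dPs iI).
case: (ex_maxnP exA ubA) => L /asboolP[Ps [dPs IPs]] mx.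
exists L, Ps; split=> // Q [pQ IQ].
apply: contrapT => /forallNP nQ; suff : (L.+1 <= L)%N by rewrite ltnn.
have iQ : is_ideal Q by case: pQ.
apply: mx; apply/asboolP; case: dPs => pPs nPs dPs.
exists (fun i => if unlift ord0 i is Some j then Ps j else Q); split; last first.
  by move=> i x; case: unliftP => [j _|_]; [exact: IPs | exact: IQ].
split.
- by move=> i; case: unliftP.
- by move=> i; case: unliftP => // _; exact: nonzero_ideal_sub nI iQ IQ.
- move=> i j; case: (unliftP ord0 i) => [i'|] ->; case: (unliftP ord0 j) => [j'|] -> //.
  + by move=> /dPs ->.
  + by move=> h; case: (nQ i') => x; split=> /h.
  + by move=> h; case: (nQ j').
Qed.

Lemma prime_ideal_nat P n : prime_ideal P -> (0 < n)%N -> P n%:R ->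
  exists2 p, prime p & P p%:R.
Proof.
move=> [iP P1 pP]; elim/ltn_ind: n => n IH n0 Pn.
case: (ltngtP n 1) => [|n1|e]; first by case: n n0 {IH Pn} => [|[]].
  have pp := pdiv_prime n1.
  have e : n = (pdiv n * (n %/ pdiv n))%N by rewrite mulnC divnK // pdiv_dvd.
  have k0 : (0 < n %/ pdiv n)%N by move: n0; rewrite {1}e muln_gt0 => /andP[].
  move: Pn; rewrite {1}e natrM => /(pP _ _ (integralOn _ _) (integralOn _ _))[h|h].
    by exists (pdiv n).
  by apply: IH h => //; rewrite ltn_Pdiv // prime_gt1.
by move: Pn; rewrite e => /P1.
Qed.

(** Two distinct numbers among [0, ..., q] are congruent modulo [P], and their difference is a
    multiple of [p]. *)
Lemma prime_le_norm P p q : prime_ideal P -> prime p -> P p%:R ->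
  ideal_norm_is P q -> (p <= q)%N.
Proof.
move=> pP pp Pp hq; have iP : is_ideal P by case: pP.
have [s es cs] := norm_covers hq.
have [i [j [ij js h]]] := covers_pigeonhole iP cs (@integralOn K).
have : (p%:Z %| (j - i)%N%:Z)%Z.
  apply: (prime_ideal_int_dvd pP pp Pp).
  by rewrite -[_%:~R]/((j - i)%N%:R) natrB // ltnW.
rewrite dvdzE /= => /dvdn_leq; rewrite subn_gt0 => /(_ ij) pji.
by rewrite -es; apply: leq_trans pji (leq_trans (leq_subr _ _) js).
Qed.

Lemma sort_ord L (q : 'I_L -> nat) : exists2 f : 'I_L -> 'I_L,
  bijective f & forall i j : 'I_L, (i <= j)%N -> (q (f i) <= q (f j))%N.
Proof.
pose s := sort (relpre q leq) (enum 'I_L).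
have ss : size s == L by rewrite size_sort size_enum_ord.
pose t := Tuple ss.
exists (tnth t).
  apply: injF_bij => i j; rewrite !(tnth_nth i) => /eqP.
  have us : uniq s by rewrite sort_uniq enum_uniq.
  by rewrite nth_uniq // ?(eqP ss) // => /eqP/val_inj.
move=> i j ij; rewrite !(tnth_nth i) /=.
have tr : transitive (relpre q leq) by move=> a b c; exact: leq_trans.
have so : sorted (relpre q leq) s by apply: sort_sorted => a b; exact: leq_total.
by apply: (sorted_leq_nth tr _ _ so) => //=; rewrite ?inE ?(eqP ss) // => a; exact: leqnn.
Qed.

Lemma covers_setI I J s s' : is_ideal I -> is_ideal J -> covers I s -> covers J s' ->
  exists2 r, size r = (size s * size s')%N & covers (fun z => I z /\ J z) r.
Proof.
move=> iI iJ [si cs] [si' cs'].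
(* Pairs of residues without a common solution get the dummy representative [0]. *)
have h (ab : K * K) : exists x, integral x /\
   ((exists y, integral y /\ I (y - ab.1) /\ J (y - ab.2)) -> I (x - ab.1) /\ J (x - ab.2)).
  case: (pselect (exists y, integral y /\ I (y - ab.1) /\ J (y - ab.2))) => [[y [iy hy]]|n].
    by exists y.
  by exists 0; split=> //; exact: integralO0.
have [g gP] := choice h.
exists [seq g (a, b) | a <- s, b <- s']; first by rewrite size_allpairs.
split.
  by move=> _ /allpairsP[[a b] /= [_ _ ->]]; case: (gP (a, b)).
move=> x ix; have [a sa Ia] := cs _ ix; have [b sb Jb] := cs' _ ix.
exists (g (a, b)); first by apply/allpairsP; exists (a, b).
have [_ [|/= h1 h2]] := gP (a, b); first by exists x.
by split; [apply: ideal_sub_trans Ia _ | apply: ideal_sub_trans Jb _] => //; exact: ideal_sub_sym.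
Qed.

Lemma covers_bigcap L (D : 'I_L -> K -> Prop) (s : 'I_L -> seq K) :
  (forall i, is_ideal (D i)) -> (forall i, covers (D i) (s i)) ->
  exists2 r, size r = (\prod_i size (s i))%N &
    covers (fun z => integral z /\ forall i, D i z) r.
Proof.
elim: L D s => [|L IH] D s iD cD.
  exists [:: 0]; first by rewrite big_ord0.
  split=> [x|x ix]; first by rewrite inE => /eqP ->; exact: integralO0.
  by exists 0; rewrite ?inE // subr0; split=> // -[].
have [r er cr] := IH (fun i => D (lift ord0 i)) (fun i => s (lift ord0 i))
  (fun i => iD _) (fun i => cD _).
have iJ : is_ideal (fun z => integral z /\ forall i, D (lift ord0 i) z).
  split.
  - by move=> x [].
  - by split; [exact: integralO0 | move=> i; exact: ideal0].
  - by move=> x y [ix hx] [iy hy]; split; [exact: integralB | move=> i; exact: idealB].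
  - by move=> x y ix [iy hy]; split; [exact: integralM | move=> i; exact: idealMl].
have [r' er' cr'] := covers_setI (iD ord0) iJ (cD ord0) cr.
exists r'; first by rewrite er' er big_ord_recl.
apply: covers_sub cr' => x [h0 [ix hx]]; split=> // i.
by case: (unliftP ord0 i) => [j|] ->.
Qed.

(** Otherwise [colon I z] is proper and lies in a prime factor [P] of [I], although it contains some
    [u] outside [P]. This recovers an ideal from its localizations. *)
Lemma ideal_meets_all_primes I z : nonzero_ideal I -> integral z ->
  (forall P, prime_factor I P -> exists u, [/\ integral u, ~ P u & I (u * z)]) -> I z.
Proof.
move=> nI iz H; have [iI _] := nI; apply: contrapT => nz.
have sub x : I x -> colon I z x by exact: colon_sub.
have nC := nonzero_ideal_sub nI (colon_ideal z iI) sub.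
have [|P [pP CP]] := proper_in_prime nC; first by case=> _; rewrite mulr1.
have [u [iu nu Iu]] : exists u, [/\ integral u, ~ P u & I (u * z)].
  by apply: H; split=> // x /sub/CP.
by apply: nu; apply: CP; split=> //; rewrite mulrC.
Qed.

Lemma chinese L (Ps : 'I_L -> K -> Prop) (t u : 'I_L -> K) (e : nat) (x : 'I_L -> K) :
  distinct_primes Ps ->
  (forall i, [/\ Ps i (t i), t i != 0, integral (u i), ~ Ps i (u i)
    & forall y, Ps i y -> princ (t i) (u i * y)]) ->
  (forall i, integral (x i)) ->
  exists2 z, integral z & forall i, dpow (Ps i) (t i) e (z - x i).
Proof.
move=> dPs H ix; have [w [wi nw Pw]] := separating dPs; have [pPs nPs _] := dPs.
have iD i : is_ideal (dpow (Ps i) (t i) e).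
  by case: (H i) => *; exact: dpow_ideal.
have f i : exists y, [/\ integral y, dpow (Ps i) (t i) e (y - 1)
    & forall j, j != i -> dpow (Ps j) (t j) e y].
  have [h1 h2 h3 h4 h5] := H i.
  have nD : nonzero_ideal (dpow (Ps i) (t i) e) by exact: dpow_nonzero.
  have iw : integral (w i ^+ e) by exact: integralX.
  have [a [k [k0 h]]] := pow_congr nD iw.
  (* The exponent [e] puts this into the required power of every other prime; the exponent [k] makes
     it 1 modulo the power of [Ps i], where [w i] is a unit. *)
  exists ((w i ^+ e) ^+ k); split; first exact: integralX.
    apply: dpow_sat h => //; first exact: integralX.
      by apply: prime_nonmem_pow => //; exact: prime_nonmem_pow.
    by apply: integralB; [exact: integralX | exact: integralO1].
  move=> j ji; have [g1 g2 g3 g4 g5] := H j.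
  rewrite -(prednK k0) exprS; apply: idealMr => //; last exact: integralX.
  by apply: (dpow_exp (pPs j) (nPs j) g3 g4 g5); exact: Pw.
have [y yP] := choice f.
exists (\sum_i x i * y i).
  by apply: integral_sum_seq => i; apply: integralM => //; case: (yP i).
move=> i; rewrite (bigD1 i) //= addrAC.
apply: idealD => //.
  have -> : x i * y i - x i = x i * (y i - 1) by ring.
  by apply: idealMl => //; case: (yP i).
apply: ideal_sum_seq => // j ji; apply: idealMl => //.
by case: (yP j) => _ _; apply; rewrite eq_sym.
Qed.
End FinitelyManyPrimes.

(* In the application [X i] represents [O / P_i ^ e], [q i] is the norm of [P_i], [p i] the
   rational prime in [P_i], [k a i] the exponent of [P_i] in the modulus of the class [a], and
   [mem a i] the image of that class in [O / P_i ^ k a i]. *)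
Record box_system (T : eqType) (n d J e : nat) (p q : 'I_J -> nat) (X : 'I_J -> seq T)
  (k : 'I_n -> 'I_J -> nat) (mem : 'I_n -> 'I_J -> pred T) : Prop := BoxSystem {
  box_prime : forall i, prime (p i);
  box_le : forall i, (p i <= q i)%N;
  box_above : forall c, (#|[set i | p i == c]| <= d)%N;
  box_mono : forall i j : 'I_J, (i <= j)%N -> (q i <= q j)%N;
  box_exp : forall a i, (k a i <= e)%N;
  box_size : forall i, size (X i) = (q i ^ e)%N;
  box_count : forall a i, (count (mem a i) (X i) * q i ^ k a i <= q i ^ e)%N }.

(** * From residue classes to boxes *)

Section Boxes.
Variable K : fieldExtType rat.
Local Open Scope ring_scope.

Lemma ideals_box_system n (a : 'I_n -> K) (I : 'I_n -> K -> Prop) :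
  (forall c, integral (a c)) -> (forall c, nonzero_ideal (I c)) ->
  exists J e p q X k mem, [/\ @box_system K n (\dim {:K}) J e p q X k mem,
    forall x : 'I_J -> K, (forall i, x i \in X i) ->
      exists2 z, integral z & forall c, I c (z - a c) -> forall i, mem c i (x i),
    forall c b, (forall i, k c i = k b i) -> same_set (I c) (I b)
  & forall c, exists2 N, ideal_norm_is (I c) N & (N <= \prod_i q i ^ k c i)%N].
Proof.
move=> ia nI.
have h c : exists m, (0 < m)%N /\ I c m%:R.
  by have [m m0 Im] := nonzero_ideal_nat (nI c); exists m.
have [m mP] := choice h.
(* [N] lies in every modulus, so the primes containing [N] include all prime factors of all
   [I c]. *)
pose N := (\prod_c m c)%N.
have N0 : (0 < N)%N by rewrite prodn_gt0 // => c; case: (mP c).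
have NI c x : princ N%:R x -> I c x.
  move=> [z iz ->]; have [iI _] := nI c; apply: idealMr => //.
  by rewrite /N (bigD1 c) //= natrM; apply: idealMr => //; [case: (mP c) | exact: integralOn].
have nN : nonzero_ideal (princ (N%:R : K)).
  split; first exact/princ_ideal/integralOn.
  exists N%:R; split; first by exists 1; [exact: integralO1 | rewrite mulr1].
  by rewrite (_ : N%:R = N%:Z%:~R) // intrK_eq0 eqz_nat -lt0n.
have [J [Ps0 [dPs0 all0]]] := all_primes nN.
have nrm0 i : exists q, ideal_norm_is (Ps0 i) q.
  by apply: norm_exists; case: dPs0.
have [q0 q0P] := choice nrm0.
have [f fb fmono] := sort_ord q0.
pose Ps i := Ps0 (f i); pose q i := q0 (f i).
have dPs : distinct_primes Ps by exact: distinct_primes_sub (bij_inj fb) dPs0.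
have [pPs nPs _] := dPs.
have qP i : ideal_norm_is (Ps i) (q i) by exact: q0P.
have allP c Q : prime_factor (I c) Q -> exists i, same_set Q (Ps i).
  move=> [pQ IQ]; have [|i Qi] := all0 Q; first by split=> // x /(NI c)/IQ.
  by have [g _ gK] := fb; exists (g i); rewrite /Ps gK.
have hp i : exists p, prime p /\ Ps i p%:R.
  have [l l0 Pl] := nonzero_ideal_nat (nPs i).
  by have [p] := prime_ideal_nat (pPs i) l0 Pl; exists p.
have [p pP] := choice hp.
have hr i : exists rs : seq K, [/\ size rs = q i, covers (Ps i) rs &
   forall l j, (l < size rs)%N -> (j < size rs)%N -> Ps i (nth 0 rs l - nth 0 rs j) -> l = j].
  have [rs [sz ri rd rc]] := qP i; exists rs; split=> //; last by rewrite sz.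
  split; first by move=> r /(nthP 0)[l]; rewrite sz => lq <-; exact: ri.
  by move=> x /rc[l lq Pl]; exists (nth 0 rs l) => //; rewrite mem_nth ?sz.
have [rs rsP] := choice hr.
have hu i : exists tu : K * K, [/\ Ps i tu.1, tu.1 != 0, integral tu.2, ~ Ps i tu.2
    & forall y, Ps i y -> princ tu.1 (tu.2 * y)].
  by have [t [u ?]] := uniformizer (pPs i) (nPs i); exists (t, u).
have [tu tuP] := choice hu.
pose t i := (tu i).1; pose u i := (tu i).2.
pose D i := dpow (Ps i) (t i).
have iD i l : is_ideal (D i l) by case: (tuP i) => *; exact: dpow_ideal.
have hk (ci : 'I_n * 'I_J) : exists l, (forall z, I ci.1 z -> D ci.2 l z) /\
    (forall z, D ci.2 l z -> exists u, [/\ integral u, ~ Ps ci.2 u & I ci.1 (u * z)]).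
  case: (tuP ci.2) => h1 h2 h3 h4 h5.
  exact: (ideal_local (pPs _) (nPs _) h1 h2 h3 h4 h5 (nI _)).
have [k' k'P] := choice hk.
pose k c i := k' (c, i).
have kI c i z : I c z -> D i (k c i) z by case: (k'P (c, i)) => + _; apply.
have Ik c z : integral z -> (forall i, D i (k c i) z) -> I c z.
  move=> iz Dz; apply: ideal_meets_all_primes => // Q /allP[i Qi].
  have [_ /(_ z (Dz i))[v [iv nv Iv]]] := k'P (c, i).
  by exists v; split=> // /Qi.
(* A common exponent, so that each prime contributes a single residue ring. *)
pose e := (\max_c \max_i k c i)%N.
have ke c i : (k c i <= e)%N.
  by apply: leq_trans (leq_bigmax c); apply: leq_trans (leq_bigmax i).
pose X i := digits (t i) (rs i) e.
pose mem c i : pred K := fun x => `[< D i (k c i) (x - a c) >].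
have cX i l : covers (D i l) (digits (t i) (rs i) l).
  case: (tuP i) (rsP i) => h1 h2 h3 h4 h5 [_ h6 _].
  exact: (digits_covers (pPs i) (nPs i) h1 h2 h3 h4 h5).
have Xint i x : x \in X i -> integral x by case: (cX i e) => + _; apply.
exists J, e, p, q, X, k, mem; split.
- split=> //.
  + by move=> i; case: (pP i).
  + by move=> i; case: (pP i) => pp Pp; exact: prime_le_norm (qP i).
  + move=> c; case: (set_0Vmem [set i | p i == c]) => [->|[i0]]; first by rewrite cards0.
    rewrite inE => /eqP ei0.
    apply: (@primes_above K _ (fun i => Ps (enum_val i)) c).
    * exact: (@distinct_primes_sub K _ _ Ps enum_val enum_val_inj).
    * by rewrite -ei0; case: (pP i0).
    * move=> i; have := enum_valP i; rewrite inE => /eqP pi.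
      by have [_] := pP (enum_val i); rewrite [X in X%:R]pi.
  + by move=> i; rewrite size_digits; case: (rsP i) => ->.
  + move=> c i; have [sz [ri _] rd] := rsP i; case: (tuP i) => h1 h2 h3 h4 h5.
    have := digits_count (pPs i) (nPs i) h1 h2 h3 h4 h5 (a c) ri rd (ke c i).
    rewrite sz -(leq_pmul2r (m := q i ^ k c i)); last first.
      rewrite expn_gt0; case: (pP i) => pp Pp.
      by rewrite (leq_trans (prime_gt0 pp) (prime_le_norm (pPs i) pp Pp (qP i))).
    by rewrite -expnD subnK.
- move=> x xX.
  have [z iz zx] := @chinese K J Ps t u e x dPs tuP (fun i => Xint i _ (xX i)).
  exists z => // c Iz i; apply/asboolP.
  have h1 := kI c i _ Iz.
  have h2 : D i (k c i) (z - x i).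
    by case: (tuP i) => *; apply: (dpow_sub _ _ (ke c i) (zx i)).
  by have := idealB (iD i (k c i)) h1 h2; congr (D _ _); ring.
- move=> c b ecb z; split=> Iz.
    by apply: Ik => [|i]; [case: (nI c) => iI _; exact: ideal_int Iz | rewrite -ecb; exact: kI].
  by apply: Ik => [|i]; [case: (nI b) => iI _; exact: ideal_int Iz | rewrite ecb; exact: kI].
- move=> c; have [M hM] := norm_exists (nI c); exists M => //.
  have [r er cr] := covers_bigcap (fun i => iD i (k c i)) (fun i => cX i (k c i)).
  have := norm_le_covers (proj1 (nI c)) hM (covers_sub _ cr).
  rewrite er; under eq_bigr => i _ do rewrite size_digits.
  under eq_bigr => i _ do have -> : size (rs i) = q i by case: (rsP i).
  by apply => x [ix Dx]; exact: Ik.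
Qed.
End Boxes.

(** * Choosing the coordinates of an uncovered point *)

Section Selection.
Variables (F : realFieldType) (T : eqType) (J : nat) (S : finType).
Local Open Scope ring_scope.
Variables (w : S -> F) (h : S -> nat) (phi : S -> 'I_J -> T -> F) (g : S -> 'I_J -> F).
Hypotheses (w0 : forall s, 0 <= w s) (phi0 : forall s i y, 0 <= phi s i y)
  (g0 : forall s i, 0 <= g s i).

(* A bound for the conditional expectation, given the first [j] coordinates of [x], of the sum
   of the [w s] times the product of the [phi s i] below the horizon [h s]. *)
Definition potential (j : nat) (x : 'I_J -> T) : F :=
  \sum_s w s * \prod_(i < J | (i < h s)%N) (if (i < j)%N then phi s i (x i) else g s i).

Definition upd (x : 'I_J -> T) (j : 'I_J) (y : T) : 'I_J -> T :=
  fun i => if i == j then y else x i.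

(** The minimum is at most the mean. Terms with horizon at most [j] do not see coordinate [j]; in
    the others [g] dominates the mean of [phi] over [Y]. *)
Lemma potential_step (x : 'I_J -> T) (j : 'I_J) (Y : seq T) : (0 < size Y)%N ->
  (forall s, (j < h s)%N -> \sum_(y <- Y) phi s j y <= (size Y)%:R * g s j) ->
  exists2 y, y \in Y & potential j.+1 (upd x j y) <= potential j x.
Proof.
move=> Y0 H; apply: contrapT => /forall2NP N.
have {}N y : y \in Y -> potential j x < potential j.+1 (upd x j y).
  by move=> yY; case: (N y) => [/(_ yY)//|/negP]; rewrite ltNge.
have : \sum_(y <- Y) potential j.+1 (upd x j y) <= (size Y)%:R * potential j x.
  rewrite /potential exchange_big mulr_sumr; apply: ler_sum => s _.
  rewrite -mulr_sumr mulrCA ler_wpM2l //.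
  have E y i : i != j -> (if (i < j.+1)%N then phi s i (upd x j y i) else g s i) =
      (if (i < j)%N then phi s i (x i) else g s i).
    by move=> ij; rewrite /upd (negPf ij) ltnS leq_eqVlt val_eqE (negPf ij).
  case: (ltnP j (h s)) => [jh|hj].
    rewrite [X in _ <= _ * X](bigD1 j) //= ltnn.
    under eq_bigr => y _.
      rewrite (bigD1 j) //= ltnSn {1}/upd eqxx.
      under eq_bigr => i /andP[_ ij] do rewrite (E y i ij).
      over.
    rewrite -mulr_suml mulrA ler_wpM2r ?H //.
    by apply: prodr_ge0 => i _; case: ifP.
  under eq_bigr => y _.
    under eq_bigr => i ih.
      rewrite E; first over.
      by apply: contraTneq ih => ->; rewrite -leqNgt.
    over.
  by rewrite big_const_seq count_predT iter_addr_0 mulr_natl.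
apply/negP; rewrite -ltNge.
rewrite mulr_natl -iter_addr_0 -(count_predT Y) -big_const_seq.
have hasY : has predT Y by rewrite has_predT.
rewrite !big_seq; apply: ltr_sum; last by move=> y; exact: N.
by case: (Y) Y0 => // y Y' _; rewrite /= inE eqxx.
Qed.
End Selection.

Section Covering.
Variables (F : realFieldType) (T : eqType) (n d J e : nat).
Local Open Scope ring_scope.
Variables (p q : 'I_J -> nat) (X : 'I_J -> seq T) (k : 'I_n -> 'I_J -> nat)
  (mem : 'I_n -> 'I_J -> pred T).
Hypothesis B : box_system d e p q X k mem.

(* The factor 2 pays for averaging over half of the fibre only. *)
Definition gfac (i : 'I_J) (m : nat) : F := if m == 0%N then 1 else 2 * (q i)%:R ^- m.

Variables (top : 'I_n -> 'I_J) (small : pred 'I_J).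

(* If [al] is the density of the boxes with last coordinate [t] at a partial point, the terms
   with horizon [t] add up to [2 * al] for small [t] and to [(2 * al) ^ 2] otherwise, so
   that a potential less than 1 forces [al < 1 / 2]. *)
Definition weight (s : 'I_n * 'I_n) : F :=
  if top s.1 != top s.2 then 0 else
  if small (top s.1) then (if s.1 == s.2 then 2 * (q (top s.1))%:R ^- k s.1 (top s.1) else 0)
  else 4 * ((q (top s.1))%:R ^- k s.1 (top s.1) * (q (top s.1))%:R ^- k s.2 (top s.1)).

Definition initial_potential : F :=
  \sum_s weight s * \prod_(i < J | (i < top s.1)%N) gfac i (maxn (k s.1 i) (k s.2 i)).

Lemma box_q_gt1 i : (1 < q i)%N.
Proof. exact: leq_trans (prime_gt1 (box_prime B i)) (box_le B i). Qed.

Let q0 i : 0 < (q i)%:R :> F.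
Proof. by rewrite ltr0n (ltn_trans _ (box_q_gt1 i)). Qed.

Let qV0 i m : 0 < (q i)%:R ^- m :> F.
Proof. by rewrite invr_gt0 exprn_gt0. Qed.

Lemma gfac_ge0 i m : 0 <= gfac i m.
Proof. by rewrite /gfac; case: ifP => // _; rewrite mulr_ge0 // ltW. Qed.

Lemma weight_ge0 s : 0 <= weight s.
Proof.
rewrite /weight; case: ifP => // _; case: ifP => _; last by rewrite !mulr_ge0 // ltW.
by case: ifP => // _; rewrite mulr_ge0 // ltW.
Qed.

Lemma box_countR a i :
  (count (mem a i) (X i))%:R <= (size (X i))%:R * (q i)%:R ^- k a i :> F.
Proof.
rewrite ler_pdivlMr ?exprn_gt0 // -natrX -natrM ler_nat (box_size B).
exact: box_count B a i.
Qed.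

Lemma sum_indicator (P : pred T) (s : seq T) :
  \sum_(y <- s) (P y)%:R = (count P s)%:R :> F.
Proof.
by elim: s => [|y s IH]; rewrite ?big_nil // big_cons IH /= natrD.
Qed.

Lemma count_has_le (A : pred 'I_n) i (s : seq T) :
  (count (fun y => [exists a, A a && mem a i y]) s <= \sum_(a | A a) count (mem a i) s)%N.
Proof.
elim: s => [|y s IH] //=.
rewrite big_split /= leq_add //.
case: existsP => //= -[a /andP[Aa my]].
by rewrite (bigD1 a) //= my.
Qed.

Theorem boxes_do_not_cover : initial_potential < 1 ->
  exists2 x : 'I_J -> T, (forall i, x i \in X i) & forall a, exists i, ~~ mem a i (x i).
Proof.
move=> P0.
pose phi (s : 'I_n * 'I_n) i y : F := (mem s.1 i y && mem s.2 i y)%:R.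
pose g (s : 'I_n * 'I_n) i : F := gfac i (maxn (k s.1 i) (k s.2 i)).
pose h (s : 'I_n * 'I_n) : nat := top s.1.
pose Pot := potential weight h phi g.
have X0 i : (0 < size (X i))%N.
  by rewrite (box_size B) expn_gt0 (ltn_trans _ (box_q_gt1 i)).
(* The invariant: boxes ending before [j] are already missed below [j], and the potential is still
   less than 1. *)
suff H j : (j <= J)%N -> exists x : 'I_J -> T, [/\ forall i, x i \in X i,
    forall a, (top a < j)%N -> exists i, ~~ mem a i (x i) /\ (i < j)%N & Pot j x < 1].
  have [x [xX xm _]] := H J (leqnn J); exists x => // a.
  by have [i []] := xm a (ltn_ord _); exists i.
elim: j => [_|j IH jJ].
  have hx i : exists y, y \in X i.
    by case: (X i) (X0 i) => // y s _; exists y; rewrite inE eqxx.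
  have [x xX] := choice hx; exists x; split=> //.
have [x [xX xm xP]] := IH (ltnW jJ).
pose o := Ordinal jJ.
(* [A] selects the boxes ending at [o] that the chosen coordinates have not yet missed; [al] bounds
   the part of the fibre they fill. *)
pose A a := (top a == o) && [forall i : 'I_J, (i < j)%N ==> mem a i (x i)].
pose al : F := \sum_(a | A a) (q o)%:R ^- k a o.
have al0 : 0 <= al by apply: sumr_ge0 => a _; exact: ltW.
have prod1 a b : A a -> A b -> \prod_(i < J | (i < top a)%N)
    (if (i < j)%N then phi (a, b) i (x i) else g (a, b) i) = 1.
  move=> /andP[/eqP ta /forallP xa] /andP[/eqP tb /forallP xb].
  apply: big1 => i; rewrite ta /= => ij; rewrite ij /phi /=.
  by have := xa i; have := xb i; rewrite ij /= => -> ->.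
have Pge0 s : 0 <= weight s * \prod_(i < J | (i < h s)%N)
    (if (i < j)%N then phi s i (x i) else g s i).
  rewrite mulr_ge0 ?weight_ge0 // prodr_ge0 // => i _.
  by case: ifP => _; [rewrite /phi ler0n | exact: gfac_ge0].
have al_half : 2 * al < 1.
  case so: (small o).
    apply: le_lt_trans xP; rewrite /Pot /potential.
    rewrite (bigID (fun s : 'I_n * 'I_n => (s.1 == s.2) && A s.1)) /=.
    rewrite -[X in X <= _]addr0 lerD ?sumr_ge0 //.
    rewrite /al mulr_sumr (reindex_onto (fun a => (a, a)) fst) /=; last first.
      by move=> [a b] /= /andP[/eqP -> _].
    rewrite [X in _ <= X](eq_bigl A); last by move=> a; rewrite !eqxx /= andbT.
    apply: ler_sum => a Aa; rewrite prod1 // mulr1 /weight /= eqxx /=.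
    by case/andP: Aa => /eqP -> _; rewrite so ?eqxx.
  suff : (2 * al) ^+ 2 < 1 by rewrite expr_lt1 // mulr_ge0.
  apply: le_lt_trans xP; rewrite /Pot /potential.
  rewrite (bigID (fun s : 'I_n * 'I_n => A s.1 && A s.2)) /=.
  rewrite -[X in X <= _]addr0 lerD ?sumr_ge0 //.
  rewrite expr2 mulrACA -natrM /al big_distrlr /= pair_big /= mulr_sumr.
  apply: ler_sum => -[a b] /= /andP[Aa Ab]; rewrite prod1 // mulr1 /weight /=.
  by case/andP: Aa => /eqP -> _; case/andP: Ab => /eqP -> _; rewrite ?eqxx so.
pose bad y := [exists a, A a && mem a o y].
pose Y := [seq y <- X o | ~~ bad y].
have cbad : (count bad (X o))%:R <= (size (X o))%:R * al.
  apply: (@le_trans _ _ (\sum_(a | A a) count (mem a o) (X o))%:R).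
    by rewrite ler_nat count_has_le.
  rewrite natr_sum /al mulr_sumr; apply: ler_sum => a _; exact: box_countR.
have Ysz : (size (X o))%:R < 2 * (size Y)%:R :> F.
  have e1 : (size (X o))%:R = (count bad (X o))%:R + (size Y)%:R :> F.
    by rewrite -natrD size_filter count_predC.
  have X0' : 0 < (size (X o))%:R :> F by rewrite ltr0n.
  nra.
have Y0 : (0 < size Y)%N by rewrite -(ltr0n F); have := ler0n F (size (X o)); lra.
have [|y yY yP] := @potential_step F T J _ weight h phi g weight_ge0
   (fun s i y => ler0n _ _) (fun s i => gfac_ge0 _ _) x o Y Y0.
  move=> [a b] _ /=; rewrite /phi /= sum_indicator /g /gfac /=.
  case: eqP => [_|/eqP m0]; first by rewrite mulr1 ler_nat count_size.
  (* Of two conditions only the one with the larger exponent is kept. Then [size (X o) < 2 * size Y]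
     accounts for the factor 2 in [gfac]. *)
  have [c ce cY] : exists2 c, maxn (k a o) (k b o) = k c o &
      (count (fun y => mem a o y && mem b o y) Y <= count (mem c o) (X o))%N.
    have fl c : (count (mem c o) Y <= count (mem c o) (X o))%N.
      by rewrite /Y count_filter sub_count // => z /andP[].
    case: (leqP (k a o) (k b o)) => _; [exists b|exists a] => //.
      by apply: leq_trans (fl b); apply: sub_count => z /andP[].
    by apply: leq_trans (fl a); apply: sub_count => z /andP[].
  rewrite ce; apply: (@le_trans _ _ ((size (X o))%:R * (q o)%:R ^- k c o)).
    by apply: le_trans (box_countR c o); rewrite ler_nat.
  by rewrite mulrA ler_wpM2r ?ltW // mulrC.
exists (upd x o y); split.
- move=> i; rewrite /upd; case: eqP => [->|_] //.
  by move: yY; rewrite mem_filter => /andP[].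
- move=> a; rewrite ltnS leq_eqVlt => /orP[ta|ta]; last first.
    have [i [ni ij]] := xm a ta; exists i; split; last exact: ltnW.
    by rewrite /upd -val_eqE /= ltn_eqF.
  case Aa : (A a).
    exists o; split=> //; rewrite /upd eqxx.
    move: yY; rewrite mem_filter => /andP[+ _]; apply: contraNN => my.
    by apply/existsP; exists a; rewrite Aa.
  move: Aa; rewrite /A -val_eqE /= ta /= => /negbT/forallPn[i].
  rewrite negb_imply => /andP[ij ni]; exists i; split; last exact: ltnW.
  by rewrite /upd -val_eqE /= ltn_eqF.
- exact: le_lt_trans yP xP.
Qed.
End Covering.

(** * Sums over exponent vectors *)

Section SumBounds.
Variable F : realFieldType.
Local Open Scope ring_scope.

(** Comparison with an Euler product: expanding the right side runs through all exponent vectors,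
    each attained at most [m] times. *)
Lemma sum_fibers (A V I : finType) (vec : A -> {ffun I -> V}) (m : nat) (H : I -> V -> F) :
  (forall v, #|[set a | vec a == v]| <= m)%N -> (forall i v, 0 <= H i v) ->
  \sum_a \prod_i H i (vec a i) <= m%:R * \prod_i \sum_v H i v.
Proof.
move=> hm H0; rewrite bigA_distr_bigA /= mulr_sumr.
rewrite (partition_big vec xpredT) //=; apply: ler_sum => v _.
under eq_bigr => a /eqP -> do over.
rewrite sumr_const -[X in X <= _]mulr_natl ler_wpM2r ?prodr_ge0 // ler_nat.
by apply: leq_trans (hm v); rewrite cardsE.
Qed.

Lemma geometric_le (r : F) e : 0 <= r -> r <= 3 / 4 ->
  \sum_(m < e.+1) (if m == 0%N :> nat then 1 else 2 * r ^+ m) <= 1 + 8 * r.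
Proof.
move=> r0 r1; rewrite big_ord_recl /= lerD2l.
have -> : \sum_(i < e) (if bump 0 i == 0%N then 1 else 2 * r ^+ bump 0 i) =
   2 * r * \sum_(i < e) r ^+ i.
  by rewrite mulr_sumr; apply: eq_bigr => i _; rewrite /bump /= exprS mulrA.
suff h : \sum_(i < e) r ^+ i <= 4.
  have -> : 8 * r = 2 * r * 4 by ring.
  by rewrite ler_wpM2l // mulr_ge0.
have h : (1 - r) * \sum_(i < e) r ^+ i <= 1.
  have := subrX1 r e; have : 0 <= r ^+ e by exact: exprn_ge0.
  set S := \sum_(i < e) _; move=> h1 h2; lra.
have : 0 <= \sum_(i < e) r ^+ i by apply: sumr_ge0 => i _; exact: exprn_ge0.
nra.
Qed.

Lemma geometric_tail_le (r : F) e : 0 <= r -> r <= 1 / 2 ->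
  \sum_(m < e.+1) (if m == 0%N :> nat then 0 else r ^+ m) <= 2 * r.
Proof.
move=> r0 r1; rewrite big_ord_recl /= add0r.
have -> : \sum_(i < e) (if bump 0 i == 0%N then 0 else r ^+ bump 0 i) =
   r * \sum_(i < e) r ^+ i.
  by rewrite mulr_sumr; apply: eq_bigr => i _; rewrite /bump /= exprS.
have h : (1 - r) * \sum_(i < e) r ^+ i <= 1.
  have := subrX1 r e; have : 0 <= r ^+ e by exact: exprn_ge0.
  set S := \sum_(i < e) _; move=> h1 h2; lra.
have h' : 0 <= \sum_(i < e) r ^+ i by apply: sumr_ge0 => i _; exact: exprn_ge0.
rewrite mulrC ler_wpM2r //; nra.
Qed.

(* With r = 1/2 the sum of the (2m+1) r^(m-1) over 1 <= m <= e is 10 - 2 (2e+5) 2^-e. *)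
Lemma pair_max_le (r : F) e : 0 <= r -> r <= 1 / 2 ->
  \sum_(k < e.+1) \sum_(l < e.+1) (if maxn k l == 0%N then 1 else 2 * r ^+ maxn k l)
    <= 1 + 20 * r.
Proof.
move=> r0 r1; pose f m : F := if m == 0%N then 1 else 2 * r ^+ m.
rewrite -/(\sum_(k < e.+1) \sum_(l < e.+1) f (maxn k l)).
suff h : \sum_(k < e.+1) \sum_(l < e.+1) f (maxn k l) <=
    1 + 2 * r * (10 - 2 * (2 * e%:R + 5) * (1 / 2) ^+ e).
  apply: le_trans h _; rewrite lerD2l.
  have : 0 <= r * (2 * (2 * e%:R + 5) * (1 / 2) ^+ e).
    have h1 : 0 <= 2 * e%:R + 5 :> F by rewrite addr_ge0 // mulr_ge0.
    by rewrite mulr_ge0 // mulr_ge0 ?exprn_ge0 ?divr_ge0 // mulr_ge0.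
  set z := 2 * (2 * _ + 5) * _; nra.
elim: e => [|e IH].
  by rewrite !big_ord1 /f /= expr0; lra.
have -> : \sum_(k < e.+2) \sum_(l < e.+2) f (maxn k l) =
    \sum_(k < e.+1) \sum_(l < e.+1) f (maxn k l) + (2 * e%:R + 3) * f e.+1.
  rewrite big_ord_recr /= [X in _ + X]big_ord_recr /= maxnn.
  have -> : \sum_(l < e.+1) f (maxn e.+1 l) = e.+1%:R * f e.+1.
    rewrite (eq_bigr (fun=> f e.+1)) ?sumr_const ?card_ord ?mulr_natl // => l _.
    by rewrite (maxn_idPl (ltnW (ltn_ord l))).
  have -> : \sum_(k < e.+1) \sum_(l < e.+2) f (maxn k l) =
      \sum_(k < e.+1) (\sum_(l < e.+1) f (maxn k l) + f e.+1).
    apply: eq_bigr => k _; rewrite big_ord_recr /=.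
    by rewrite (maxn_idPr (ltnW (ltn_ord k))).
  rewrite big_split /= sumr_const card_ord -[f e.+1 *+ e.+1]mulr_natl -natr1.
  by ring.
have fe : f e.+1 <= 2 * r * (1 / 2) ^+ e.
  rewrite /f /= exprS mulrA ler_wpM2l ?mulr_ge0 //.
  by rewrite lerXn2r // nnegrE // divr_ge0.
have f0 : 0 <= f e.+1 by rewrite /f /= mulr_ge0 // exprn_ge0.
have e0 : 0 <= e%:R :> F by exact: ler0n.
have -> : (e.+1%:R : F) = e%:R + 1 by rewrite -natr1.
rewrite exprS; move: IH fe f0; set S := \sum_(k < e.+1) _; set z := (1 / 2) ^+ e.
move=> IH fe f0.
have : (2 * e%:R + 3) * f e.+1 <= (2 * e%:R + 3) * (2 * r * z).
  by rewrite ler_wpM2l // addr_ge0 // mulr_ge0.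
move=> h; apply: le_trans (lerD IH h) _; lra.
Qed.
End SumBounds.

(** * Bounding the initial potential by Euler products *)

Section InitialPotential.
Variables (F : realFieldType) (T : eqType) (n d J e : nat).
Local Open Scope ring_scope.
Variables (p q : 'I_J -> nat) (X : 'I_J -> seq T) (k : 'I_n -> 'I_J -> nat)
  (mem : 'I_n -> 'I_J -> pred T).
Hypothesis B : box_system d e p q X k mem.
Variables (top : 'I_n -> 'I_J) (small : pred 'I_J) (s : nat) (y : 'I_J -> F) (Y : F).
Hypothesis top_gt0 : forall a, (0 < k a (top a))%N.
Hypothesis top_max : forall a (i : 'I_J), (top a < i)%N -> k a i = 0%N.
Hypothesis small_down : forall i j : 'I_J, (i <= j)%N -> small j -> small i.
Hypothesis fibers : forall a, (#|[set b | [forall i, k b i == k a i]]| <= s)%N.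
Hypothesis y0 : forall i, 0 <= y i.
Hypothesis yq : forall i, small i -> y i / (q i)%:R <= 3 / 4.
Hypothesis Y0 : 0 < Y.
Hypothesis Yle : forall a, small (top a) -> Y <= \prod_i y i ^+ k a i.

Local Notation Q i := ((q i)%:R : F).
Local Notation gfac := (gfac F q).

Let vec a : {ffun 'I_J -> 'I_e.+1} := [ffun i => inord (k a i)].

Let vecE a i : vec a i = k a i :> nat.
Proof. by rewrite ffunE inordK // ltnS (box_exp B). Qed.

Let vec_fibers v : (#|[set a | vec a == v]| <= s)%N.
Proof.
case: (set_0Vmem [set a | vec a == v]) => [->|[a]]; first by rewrite cards0.
rewrite inE => /eqP <-; apply: leq_trans (fibers a); apply: subset_leq_card.
apply/fintype.subsetP => b; rewrite !inE => /eqP e1; apply/forallP => i.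
by rewrite -!vecE e1.
Qed.

Let q2 i : (2 <= q i)%N. Proof. exact: box_q_gt1 B i. Qed.

Let Q0 i : 0 < Q i. Proof. by rewrite ltr0n ltnW. Qed.

Let QV0 i : 0 <= (Q i)^-1. Proof. by rewrite invr_ge0 ltW. Qed.

Let QV i : (Q i)^-1 <= 1 / 2.
Proof. by rewrite div1r lef_pV2 ?posrE // ler_nat. Qed.

Let prod_top a (f : 'I_J -> nat -> F) : (forall i, f i 0%N = 1) ->
  \prod_i f i (k a i) = f (top a) (k a (top a)) * \prod_(i < J | (i < top a)%N) f i (k a i).
Proof.
move=> f1; rewrite (bigD1 (top a)) //=; congr (_ * _).
rewrite [LHS]big_mkcond [RHS]big_mkcond /=; apply: eq_bigr => i _.
case: (ltngtP i (top a)) => [ia|ia|/val_inj ->]; rewrite ?eqxx //.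
  by rewrite ifT // -val_eqE /= ltn_eqF.
by rewrite ifT ?top_max // -val_eqE /= gtn_eqF.
Qed.

(** Rankin's trick: each term is multiplied by its product of the [y i ^ k a i] over [Y], which is
    at least 1. As the coordinates are sorted, a small last coordinate makes the exponents at all
    other primes vanish. *)
Lemma small_part :
  \sum_(a | small (top a)) 2 * Q (top a) ^- k a (top a) *
     \prod_(i < J | (i < top a)%N) gfac i (k a i)
  <= s%:R / Y * \prod_(i | small i) (1 + 8 * (y i / Q i)).
Proof.
pose H i (v : 'I_e.+1) : F :=
  if small i then (if v == 0%N :> nat then 1 else 2 * (y i / Q i) ^+ v)
  else (v == 0%N :> nat)%:R.
have H0 i v : 0 <= H i v.
  rewrite /H; case: ifP => _; last exact: ler0n.
  by case: ifP => // _; rewrite mulr_ge0 // exprn_ge0 // mulr_ge0.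
apply: (@le_trans _ _ (Y^-1 * \sum_a \prod_i H i (vec a i))); last first.
  rewrite mulrAC mulrC ler_wpM2r ?invr_ge0 ?(ltW Y0) //.
  apply: le_trans (sum_fibers vec_fibers H0) _.
  rewrite ler_wpM2l // [X in _ <= X]big_mkcond /=.
  apply: ler_prod => i _; apply/andP; split; first exact: sumr_ge0.
  rewrite /H; case: ifP => si.
    by apply: geometric_le; [rewrite mulr_ge0 | exact: yq].
  by rewrite big_ord_recl /= big1 ?addr0.
rewrite [X in _ <= _ * X](bigID (fun a => small (top a))) /= mulrDr.
rewrite -[X in X <= _]addr0 lerD //; last first.
  by rewrite mulr_ge0 ?invr_ge0 ?(ltW Y0) // sumr_ge0 // => a _; exact: prodr_ge0.
rewrite mulr_sumr; apply: ler_sum => a sa.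
have -> : \prod_i H i (vec a i) = (\prod_i gfac i (k a i)) * \prod_i y i ^+ k a i.
  rewrite -big_split /=; apply: eq_bigr => i _; rewrite /H vecE /gfac.
  case: eqP => [->|k0]; first by rewrite expr0 mulr1; case: ifP.
  rewrite ifT; first by rewrite exprMn exprVn; ring.
  apply: small_down sa; rewrite leqNgt; apply/negP => /top_max; exact: k0.
have -> : \prod_i gfac i (k a i) = 2 * Q (top a) ^- k a (top a) *
     \prod_(i < J | (i < top a)%N) gfac i (k a i).
  rewrite (prod_top a (f := gfac)); last by move=> i; rewrite /gfac.
  by rewrite {1}/gfac gtn_eqF.
rewrite mulrCA -[X in X <= _]mulr1 ler_wpM2l //.
  rewrite mulr_ge0 //; first by rewrite mulr_ge0 // invr_ge0 exprn_ge0 // ltW.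
  by apply: prodr_ge0 => i _; exact: (gfac_ge0 F B).
by rewrite mulrC ler_pdivlMr // mul1r Yle.
Qed.

(** Pairs of classes are grouped by pairs of exponent vectors, at most [s ^ 2] to a group. At [t]
    both exponents are positive, whence the square of [2 / Q t]; beyond [t] both vanish; below [t],
    [pair_max_le] applies. *)
Lemma large_part (t : 'I_J) :
  \sum_(c : 'I_n * 'I_n | (top c.1 == t) && (top c.2 == t))
     Q t ^- k c.1 t * Q t ^- k c.2 t *
     \prod_(i < J | (i < t)%N) gfac i (maxn (k c.1 i) (k c.2 i))
  <= (s ^ 2)%:R * (4 / Q t ^+ 2) * \prod_(i < J | (i < t)%N) (1 + 20 / Q i).
Proof.
pose V : finType := ('I_e.+1 * 'I_e.+1)%type.
pose z (m : nat) : F := if m == 0%N then 0 else (Q t)^-1 ^+ m.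
pose H (i : 'I_J) (v : V) : F :=
  if (i < t)%N then gfac i (maxn v.1 v.2)
  else if i == t then z v.1 * z v.2 else ((v.1 == 0%N :> nat) && (v.2 == 0%N :> nat))%:R.
have z0 m : 0 <= z m by rewrite /z; case: ifP => // _; exact: exprn_ge0.
have H0 i v : 0 <= H i v.
  rewrite /H; case: ifP => _; first exact: (gfac_ge0 F B).
  by case: ifP => _; [exact: mulr_ge0 | exact: ler0n].
pose vec2 (c : 'I_n * 'I_n) : {ffun 'I_J -> V} := [ffun i => (vec c.1 i, vec c.2 i)].
have f2 v : (#|[set c | vec2 c == v]| <= s ^ 2)%N.
  pose v1 := [ffun i => (v i).1]; pose v2 := [ffun i => (v i).2].
  apply: (@leq_trans #|finset.setX [set a | vec a == v1] [set a | vec a == v2]|).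
    apply/subset_leq_card/fintype.subsetP => -[a b]; rewrite !inE /= => /eqP e2.
    by apply/andP; split; apply/eqP/ffunP => i; rewrite /v1 /v2 -e2 !ffunE.
  by rewrite cardsX -mulnn leq_mul // vec_fibers.
apply: (@le_trans _ _ (\sum_c \prod_i H i (vec2 c i))); last first.
  apply: le_trans (sum_fibers f2 H0) _.
  rewrite -mulrA ler_wpM2l // (bigD1 t) //=.
  have sumV (i : 'I_J) (f : 'I_e.+1 -> 'I_e.+1 -> F) : \sum_(v : V) f v.1 v.2 =
      \sum_(a < e.+1) \sum_(b < e.+1) f a b by rewrite pair_bigA.
  apply: ler_pM.
  - by apply: sumr_ge0.
  - by apply: prodr_ge0 => i _; exact: sumr_ge0.
  - rewrite /H ltnn eqxx (sumV t (fun a b => z a * z b)) -big_distrlr /= -expr2.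
    have -> : 4 / Q t ^+ 2 = (2 * (Q t)^-1) ^+ 2 by field; rewrite gt_eqF.
    rewrite lerXn2r ?nnegrE ?mulr_ge0 ?sumr_ge0 //.
    exact: geometric_tail_le.
  - rewrite big_mkcond [X in _ <= X]big_mkcond /=; apply: ler_prod => i _.
    apply/andP; split; first by case: ifP => // _; exact: sumr_ge0.
    case: eqP => [->|/eqP it] /=; first by rewrite ltnn.
    rewrite /H (negPf it); case: ifP => _.
      rewrite (sumV i (fun a b => gfac i (maxn a b))) /gfac.
      under eq_bigr => a _ do under eq_bigr => b _ do rewrite -exprVn.
      exact: pair_max_le.
    rewrite (sumV i (fun a b => ((a == 0%N :> nat) && (b == 0%N :> nat))%:R)).
    rewrite big_ord_recl big_ord_recl /= big1 // big1 ?addr0 // => a _.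
    by rewrite big1.
rewrite [X in _ <= X](bigID (fun c => (top c.1 == t) && (top c.2 == t))) /=.
rewrite -[X in X <= _]addr0 lerD //; last first.
  by rewrite sumr_ge0 // => c _; exact: prodr_ge0.
apply: ler_sum => -[a b] /= /andP[/eqP ta /eqP tb].
have h (i : 'I_J) : H i (vec2 (a, b) i) = if (i < t)%N then gfac i (maxn (k a i) (k b i))
    else if i == t then Q t ^- k a t * Q t ^- k b t else 1.
  rewrite /H [vec2 _ _]ffunE /= !vecE; case: ltngtP => [//|it|/val_inj ->].
    have -> : (i == t) = false by rewrite -val_eqE /= gtn_eqF.
    by rewrite !top_max ?ta ?tb.
  have ka : k a t == 0%N = false by rewrite -ta gtn_eqF.
  have kb : k b t == 0%N = false by rewrite -tb gtn_eqF.
  by rewrite eqxx /z ka kb !exprVn.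
rewrite [X in _ <= X](eq_bigr _ (fun i _ => h i)).
rewrite [X in _ <= X](bigD1 t) //= ltnn eqxx ler_wpM2l //.
  by rewrite mulr_ge0 // invr_ge0 exprn_ge0 // ltW.
rewrite big_mkcond [X in _ <= X]big_mkcond /= le_eqVlt; apply/orP; left.
apply/eqP/eq_bigr => i _.
by case: eqP => [->|_]; rewrite ?ltnn.
Qed.

(** The constant 16 is the 4 of [weight] times the 4 of [large_part]. *)
Theorem initial_potential_le : initial_potential F q k top small <=
  s%:R / Y * \prod_(i | small i) (1 + 8 * (y i / Q i)) +
  \sum_(t | ~~ small t) 16 * (s ^ 2)%:R / Q t ^+ 2 * \prod_(i < J | (i < t)%N) (1 + 20 / Q i).
Proof.
rewrite /initial_potential (bigID (fun c : 'I_n * 'I_n => small (top c.1))) /=.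
apply: lerD.
  apply: le_trans small_part.
  rewrite (bigID (fun c : 'I_n * 'I_n => c.1 == c.2)) /= [X in _ + X]big1 ?addr0; last first.
    move=> [a b] /= /andP[sa ab]; rewrite /weight /= sa (negPf ab).
    by case: ifP; rewrite mul0r.
  rewrite (reindex_onto (fun a => (a, a)) fst) /=; last by move=> [a b] /= /andP[_ /eqP ->].
  rewrite (eq_bigl (fun a => small (top a))); last by move=> a; rewrite !eqxx !andbT.
  apply: ler_sum => a sa; rewrite /weight /= !eqxx /= sa.
  by under eq_bigr => i _ do rewrite maxnn.
rewrite (partition_big (fun c => top c.1) (fun t => ~~ small t)) //=.
apply: ler_sum => t st.
have -> : 16 * (s ^ 2)%:R / Q t ^+ 2 * \prod_(i < J | (i < t)%N) (1 + 20 / Q i) =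
  4 * ((s ^ 2)%:R * (4 / Q t ^+ 2) * \prod_(i < J | (i < t)%N) (1 + 20 / Q i)).
  by ring.
apply: le_trans (ler_wpM2l _ (large_part t)) => //.
rewrite mulr_sumr (bigID (fun c : 'I_n * 'I_n => top c.2 == t)) /=.
rewrite [X in _ + X]big1 ?addr0; last first.
  by move=> [a b] /= /andP[/andP[_ /eqP ta] tb]; rewrite /weight /= ta eq_sym tb mul0r.
rewrite (eq_bigl (fun c : 'I_n * 'I_n => (top c.1 == t) && (top c.2 == t))); last first.
  by move=> [a b] /=; case: eqP => [->|]; rewrite ?andbF ?st.
apply: ler_sum => -[a b] /= /andP[/eqP ta /eqP tb].
by rewrite /weight /= ta tb eqxx /= (negPf st) -[X in X <= _]mulrA.
Qed.
End InitialPotential.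

(** * Sums over prime ideals *)

Lemma fact_le_exp n : (n`! <= n ^ n)%N.
Proof.
have -> : (n ^ n = \prod_(1 <= i < n.+1) n)%N by rewrite prod_nat_const_nat subSS subn0.
rewrite fact_prod.
rewrite big_nat [X in (_ <= X)%N]big_nat.
by apply: leq_prod => i /andP[_]; rewrite ltnS.
Qed.

(** From the factorization of the factorial only primes up to [n] are kept, and of Legendre's
    formula only the first term [n %/ c]. *)
Lemma prime_prod_le n : (0 < n)%N -> (\prod_(c < n.+1 | prime c) c ^ (n %/ c) <= n ^ n)%N.
Proof.
move=> n0; apply: leq_trans (fact_le_exp n).
have f0 := fact_gt0 n.
rewrite -[X in (_ <= X)%N](partnT f0) /partn [X in (_ <= X)%N](eq_bigl xpredT) //.
rewrite -(big_mkord prime (fun c => c ^ (n %/ c))%N) /=.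
rewrite (@big_cat_nat _ _ _ n.+1 0 (n`!).+1) //=; last by rewrite ltnS fact_geq.
have tail0 : (0 < \prod_(n.+1 <= i < (n`!).+1) i ^ logn i n`!)%N.
  rewrite big_nat; apply: prodn_cond_gt0 => i /andP[h _].
  by rewrite expn_gt0 (leq_ltn_trans _ h).
apply: leq_trans (leq_pmulr _ tail0).
rewrite big_mkcond /= !big_nat; apply: leq_prod => i /andP[_]; rewrite ltnS => iN.
case: ifP => [pi|npi]; last by rewrite lognE npi andFb expn0.
rewrite leq_exp2l ?prime_gt1 // logn_fact // big_ltn ?ltnS // expn1.
exact: leq_addr.
Qed.

Section Mertens.
Variable R : realType.
Local Open Scope ring_scope.

Lemma ln2_ge : 1 / 2 <= ln (2 : R).
Proof.
rewrite -[X in X <= _](expRK (1 / 2 : R)) ler_ln ?posrE ?expR_gt0 //.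
have h := expR_ge1Dx (- (1 / 2) : R).
have h2 := expRxMexpNx_1 (1 / 2 : R).
have h3 := expR_gt0 (1 / 2 : R); nra.
Qed.

(** [1 - 1 / 8 <= exp (- 1 / 8)] gives [exp (1 / 8) <= 8 / 7]; three squarings, rounded up, stay
    below 3. This makes [ln (ln (s + 2))] positive for [s >= 1]. *)
Lemma ln3_gt1 : 1 < ln (3 : R).
Proof.
rewrite -[X in X < _](expRK (1 : R)) ltr_ln ?posrE ?expR_gt0 //.
have h := expR_ge1Dx (- (1 / 8) : R).
have h2 := expRxMexpNx_1 (1 / 8 : R).
have h3 := expR_gt0 (1 / 8 : R).
have -> : expR (1 : R) = ((expR (1 / 8) ^+ 2) ^+ 2) ^+ 2.
  by rewrite -!expRM_natl; congr expR; field.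
have h4 : expR (1 / 8 : R) <= 8 / 7 by nra.
have h5 : expR (1 / 8 : R) ^+ 2 <= 131 / 100 by nra.
have h6 : (expR (1 / 8 : R) ^+ 2) ^+ 2 <= 43 / 25.
  have : 0 <= expR (1 / 8 : R) ^+ 2 by rewrite exprn_ge0 // ltW.
  move: h5; set z := expR (1 / 8 : R) ^+ 2; nra.
have : 0 <= (expR (1 / 8 : R) ^+ 2) ^+ 2 by rewrite !exprn_ge0 // ltW.
move: h6; set z := (expR (1 / 8 : R) ^+ 2) ^+ 2; nra.
Qed.

Lemma ln_nat_ge0 n : 0 <= ln (n%:R : R).
Proof. by case: n => [|n]; [rewrite ln0 | rewrite ln_ge0 // ler1n]. Qed.

Lemma ler_ln_nat m n : (0 < m)%N -> (m <= n)%N -> ln (m%:R : R) <= ln n%:R.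
Proof.
by move=> m0 mn; rewrite ler_ln ?posrE ?ltr0n ?(leq_trans m0) // ler_nat.
Qed.

Lemma ln_prod_nat (I : finType) (P : pred I) (f : I -> nat) :
  (forall i, P i -> (0 < f i)%N) ->
  ln ((\prod_(i | P i) f i)%N%:R : R) = \sum_(i | P i) ln (f i)%:R.
Proof.
move=> f0.
have : (0 < \prod_(i | P i) f i)%N /\
  ln ((\prod_(i | P i) f i)%N%:R : R) = \sum_(i | P i) ln (f i)%:R.
  elim/big_rec2: _ => [|i y m Pi [m0 <-]]; first by rewrite ln1.
  by rewrite muln_gt0 f0 // m0 natrM lnM ?posrE ?ltr0n ?f0.
by case.
Qed.

(** The logarithm of [prime_prod_le]; the factor 2 pays for the floor, as [n / c <= 2 * (n %/ c)]
    for [c <= n]. *)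
Lemma mertens n : (0 < n)%N ->
  \sum_(c < n.+1 | prime c) ln (c%:R : R) / c%:R <= 2 * ln n%:R.
Proof.
move=> n0; have nR : 0 < n%:R :> R by rewrite ltr0n.
rewrite -(ler_pM2l nR).
have h : \sum_(c < n.+1 | prime c) (n %/ c)%:R * ln (c%:R : R) <= n%:R * ln n%:R.
  have := ler_ln_nat _ (prime_prod_le n0).
  rewrite natrX lnXn // mulr_natl ln_prod_nat; last first.
    by move=> c pc; rewrite expn_gt0 prime_gt0.
  have -> : \sum_(c < n.+1 | prime c) ln ((c ^ (n %/ c))%:R : R) =
     \sum_(c < n.+1 | prime c) (n %/ c)%:R * ln (c%:R : R).
    apply: eq_bigr => c pc; rewrite natrX lnXn ?mulr_natl // ltr0n.
    exact: prime_gt0.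
  apply; rewrite prodn_cond_gt0 // => c pc.
  by rewrite expn_gt0 prime_gt0.
have -> : n%:R * (2 * ln n%:R) = 2 * (n%:R * ln n%:R) :> R by ring.
apply: le_trans (ler_wpM2l _ h) => //; rewrite !mulr_sumr.
apply: ler_sum => c pc; have c0 := prime_gt0 pc.
have cR : 0 < c%:R :> R by rewrite ltr0n.
have -> : n%:R * (ln c%:R / c%:R) = n%:R / c%:R * ln c%:R :> R by ring.
rewrite mulrA ler_wpM2r ?ln_nat_ge0 // ler_pdivrMr // -!natrM ler_nat.
have := divn_eq n c; have := ltn_pmod n c0.
have : (0 < n %/ c)%N by rewrite divn_gt0 // -ltnS.
move: (n %/ c)%N (n %% c)%N => x y; nia.
Qed.

(** Substitute for monotonicity of [ln x / x], which fails near 2; it passes from a norm to the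
    prime below it. *)
Lemma ln_div_le (p q : nat) : (1 < p)%N -> (p <= q)%N ->
  ln (q%:R : R) / q%:R <= 3 * (ln (p%:R : R) / p%:R).
Proof.
move=> p1 pq; have p0 : 0 < p%:R :> R by rewrite ltr0n ltnW.
have q0 : 0 < q%:R :> R by rewrite ltr0n (leq_trans _ pq) // ltnW.
have pqR : p%:R <= q%:R :> R by rewrite ler_nat.
have lp : 1 / 2 <= ln (p%:R : R) by apply: le_trans ln2_ge (ler_ln_nat _ p1).
have h : ln (q%:R : R) <= ln p%:R + q%:R / p%:R.
  have -> : q%:R = p%:R * (q%:R / p%:R) :> R by field; rewrite gt_eqF.
  rewrite lnM ?posrE ?divr_gt0 // mulrCA divff ?mulr1 ?gt_eqF // lerD2l.
  by apply/ltW/ln_sublinear; rewrite divr_gt0.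
rewrite ler_pdivrMr //; apply: le_trans h _.
have e : 3 * (ln p%:R / p%:R) * q%:R = 3 * ln p%:R * (q%:R / p%:R) :> R by ring.
rewrite e; have h1 : 1 <= q%:R / p%:R :> R by rewrite ler_pdivlMr // mul1r.
nra.
Qed.

(** Meant for the inverse square roots of [n] and [n + 1]. Here [a ^ 2 * b ^ 2 = (a - b) * (a + b)
    <= 2 * a * (a - b)]. *)
Lemma inv_sqrt_telescope (a b : R) : 0 < b -> b <= a -> a ^+ 2 - b ^+ 2 = a ^+ 2 * b ^+ 2 ->
  b ^+ 3 <= 2 * (a - b).
Proof.
move=> b0 ba e; have a0 : 0 < a by exact: lt_le_trans ba.
have h : a * b ^+ 2 <= 2 * (a - b).
  rewrite -(ler_pM2l a0).
  have -> : a * (a * b ^+ 2) = a ^+ 2 * b ^+ 2 by ring.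
  by rewrite -e; nra.
by apply: le_trans h; rewrite exprS ler_wpM2r // exprn_ge0 // ltW.
Qed.

Lemma sum_three_halves n :
  \sum_(c < n.+1 | (0 < c)%N) expR (- (3 / 2) * ln (c%:R : R)) <= 3.
Proof.
case: n => [|n]; first by rewrite big_mkcond big_ord1.
suff h : \sum_(c < n.+2 | (0 < c)%N) expR (- (3 / 2) * ln (c%:R : R)) <=
   3 - 2 * expR (- (1 / 2) * ln n.+1%:R).
  by apply: le_trans h _; have := expR_gt0 (- (1 / 2) * ln (n.+1%:R : R)); lra.
elim: n => [|n IH].
  by rewrite big_mkcond !big_ord_recl big_ord0 /= ln1 !mulr0 expR0; lra.
rewrite big_mkcond big_ord_recr /= -big_mkcond.
apply: le_trans (lerD IH (lexx _)) _.
set a := expR (- (1 / 2) * ln n.+1%:R); set b := expR (- (1 / 2) * ln n.+2%:R).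
have -> : expR (- (3 / 2) * ln (n.+2%:R : R)) = b ^+ 3.
  by rewrite /b -expRM_natl; congr expR; field.
have sq m : expR (- (1 / 2) * ln (m.+1%:R : R)) ^+ 2 = m.+1%:R^-1.
  rewrite -expRM_natl.
  have -> : 2%:R * (- (1 / 2) * ln m.+1%:R) = - ln (m.+1%:R : R) by field.
  by rewrite expRN lnK // posrE.
suff : b ^+ 3 <= 2 * (a - b) by lra.
apply: inv_sqrt_telescope; first exact: expR_gt0.
  rewrite ler_expR; have := ler_ln_nat (isT : (0 < n.+1)%N) (leqnSn n.+1); lra.
rewrite /a /b !sq -[n.+2%:R]natr1.
have N0 : 0 < n.+1%:R :> R by [].
field; apply/andP; split; apply: lt0r_neq0; lra.
Qed.

Variables (J d : nat) (p q : 'I_J -> nat).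
Hypotheses (pp : forall i, prime (p i)) (pq : forall i, (p i <= q i)%N).
Hypothesis above : forall c, (#|[set i | p i == c]| <= d)%N.

Lemma sum_above (f : nat -> R) n : (forall c, 0 <= f c) ->
  \sum_(i | (p i <= n)%N) f (p i) <= d%:R * \sum_(c < n.+1 | prime c) f c.
Proof.
move=> f0; rewrite mulr_sumr.
rewrite (partition_big (fun i => inord (p i) : 'I_n.+1) (fun c => prime c)) /=; last first.
  by move=> i pn; rewrite inordK.
apply: ler_sum => c _.
rewrite (eq_bigr (fun=> f c)); last first.
  by move=> i /andP[pn /eqP <-]; rewrite inordK.
rewrite sumr_const -[X in X <= _]mulr_natl ler_wpM2r // ler_nat.
apply: leq_trans (above c); apply: subset_leq_card.
by apply/fintype.subsetP => i /andP[pn /eqP <-]; rewrite inE inordK.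
Qed.

Let q1 i : (1 < q i)%N. Proof. exact: leq_trans (prime_gt1 (pp i)) (pq i). Qed.

Let lnq0 i : 0 <= ln (q i)%:R / (q i)%:R :> R.
Proof. by rewrite divr_ge0 ?ln_nat_ge0. Qed.

Lemma mertens_ideals x : (0 < x)%N ->
  \sum_(i | (q i <= x)%N) ln ((q i)%:R : R) / (q i)%:R <= 6 * d%:R * ln x%:R.
Proof.
move=> x0.
apply: (@le_trans _ _ (\sum_(i | (p i <= x)%N) 3 * (ln (p i)%:R / (p i)%:R))).
  rewrite big_mkcond [X in _ <= X]big_mkcond /=; apply: ler_sum => i _.
  case: ifP => qx.
    by rewrite (leq_trans (pq i) qx) ln_div_le // prime_gt1.
  by case: ifP => // _; rewrite mulr_ge0 // divr_ge0 ?ln_nat_ge0.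
rewrite -mulr_sumr.
have h := @sum_above (fun c => ln c%:R / c%:R) x (fun c => divr_ge0 (ln_nat_ge0 _) (ler0n _ _)).
have m := ler_wpM2l (ler0n R d) (mertens x0).
have := le_trans h m; set S := \sum_(i | _) _; lra.
Qed.

Lemma sum_inv_small x : (0 < x)%N ->
  \sum_(i | (q i <= x)%N) ((q i)%:R : R)^-1 <= 12 * d%:R * ln x%:R.
Proof.
move=> x0; have := mertens_ideals x0.
suff h : \sum_(i | (q i <= x)%N) ((q i)%:R : R)^-1 <=
   2 * \sum_(i | (q i <= x)%N) ln ((q i)%:R : R) / (q i)%:R by lra.
rewrite mulr_sumr; apply: ler_sum => i _.
rewrite mulrA -[X in X <= _]mul1r ler_wpM2r ?invr_ge0 //.
by have := le_trans ln2_ge (@ler_ln_nat 2 _ isT (q1 i)); lra.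
Qed.

(** Above [y] one uses [1 <= ln q / ln y]. A large fixed [y] makes the coefficient of [ln x] as
    small as desired. *)
Lemma sum_inv_le y x : (1 < y)%N -> (0 < x)%N ->
  \sum_(i | (q i <= x)%N) ((q i)%:R : R)^-1 <=
  12 * d%:R * ln y%:R + 6 * d%:R / ln y%:R * ln x%:R.
Proof.
move=> y1 x0; have ly : 0 < ln (y%:R : R) by rewrite ln_gt0 // ltr1n.
have h1 := sum_inv_small (ltnW y1).
have h2 := mertens_ideals x0.
have -> : 6 * d%:R / ln y%:R * ln x%:R = 6 * d%:R * ln x%:R / ln y%:R :> R by ring.
have h3 : (\sum_(i | (q i <= x)%N) ln ((q i)%:R : R) / (q i)%:R) / ln y%:R <=
    6 * d%:R * ln x%:R / ln y%:R by rewrite ler_pM2r ?invr_gt0.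
apply: le_trans (lerD h1 h3).
rewrite mulr_suml big_mkcond [X in _ <= X + _]big_mkcond [X in _ <= _ + X]big_mkcond /=.
rewrite -big_split /=; apply: ler_sum => i _.
have V0 : 0 <= ((q i)%:R : R)^-1 by rewrite invr_ge0.
case: (leqP (q i) x) => qx; last by rewrite addr0; case: ifP.
case: (leqP (q i) y) => qy.
  by rewrite lerDl divr_ge0 // ltW.
rewrite add0r mulrAC -[X in X <= _]mul1r ler_wpM2r // ler_pdivlMr // mul1r.
by apply: ler_ln_nat; [exact: ltnW | exact: ltnW].
Qed.

Lemma sum_three_halves_ideals :
  \sum_i expR (- (3 / 2) * ln ((p i)%:R : R)) <= 3 * d%:R.
Proof.
pose n := (\max_i p i)%N.
have h := @sum_above (fun c => expR (- (3 / 2) * ln c%:R)) n (fun c => ltW (expR_gt0 _)).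
rewrite (eq_bigl xpredT) in h; last by move=> i; rewrite leq_bigmax.
apply: le_trans h _; rewrite mulrC ler_wpM2r //.
apply: le_trans (sum_three_halves n).
rewrite big_mkcond [X in _ <= X]big_mkcond /=; apply: ler_sum => c _.
by case: ifP => [/prime_gt0 ->//|_]; case: ifP => // _; exact/ltW/expR_gt0.
Qed.
End Mertens.

(** * Choice of the parameters *)

Section Constants.
Variable R : realType.
Local Open Scope ring_scope.

Lemma prod_1D_le (I : finType) (P : pred I) (f : I -> R) : (forall i, P i -> 0 <= f i) ->
  \prod_(i | P i) (1 + f i) <= expR (\sum_(i | P i) f i).
Proof.
move=> f0; rewrite expR_sum; apply: ler_prod => i Pi.
by rewrite expR_ge1Dx andbT addr_ge0 ?f0.
Qed.

Lemma expR_le_1D (u : R) : expR u <= 1 + u * expR u.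
Proof.
have h1 := expR_ge1Dx (- u); have h2 := expRxMexpNx_1 u; have h3 := expR_gt0 u.
have : expR u * (1 + - u) <= 1 by rewrite -[X in _ <= X]h2 ler_pM2l.
lra.
Qed.

Section Bounds.
Variables (J d : nat) (p q : 'I_J -> nat).
Hypotheses (pp : forall i, prime (p i)) (pq : forall i, (p i <= q i)%N).
Hypothesis above : forall c, (#|[set i | p i == c]| <= d)%N.
Local Notation Q i := ((q i)%:R : R).

Let q1 i : (1 < q i)%N. Proof. exact: leq_trans (prime_gt1 (pp i)) (pq i). Qed.
Let Q0 i : 0 < Q i. Proof. by rewrite ltr0n ltnW. Qed.
Let lnQ0 i : 0 <= ln (Q i). Proof. exact: ln_nat_ge0. Qed.

Lemma rankin_ratio (sg : R) i : sg <= 1 / 2 -> expR (sg * ln (Q i)) / Q i <= 3 / 4.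
Proof.
move=> sg2; set r := expR _ / _.
have r0 : 0 <= r by rewrite divr_ge0 // ?ltW // expR_gt0.
suff : r ^+ 2 <= (3 / 4) ^+ 2 by nra.
have Qi : (Q i)^-1 <= 1 / 2 by rewrite div1r lef_pV2 ?posrE // ler_nat.
have -> : r ^+ 2 = expR (2 * (sg * ln (Q i))) / Q i ^+ 2.
  by rewrite /r expr_div_n -expRM_natl.
have h : expR (2 * (sg * ln (Q i))) <= Q i.
  rewrite -[X in _ <= X](lnK (_ : Q i \is Num.pos)) ?posrE // ler_expR.
  have := lnQ0 i; nra.
apply: (@le_trans _ _ (Q i)^-1); last by lra.
by rewrite ler_pdivrMr ?exprn_gt0 // expr2 mulKf // gt_eqF.
Qed.

(** With [r = T ^ sg] the square root of [ln T], [ln r < r] gives [sg * r <= 1]. Hence [q ^ sg <= 1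
    + sg * l * r <= 1 + l <= 3 * l] for [l = ln q >= 1 / 2], and [144 = 8 * 3 * 6] with the 6 of
    [mertens_ideals]. *)
Lemma rankin_product (T : nat) (sg : R) : (1 < T)%N -> 1 < ln (T%:R : R) ->
  sg = ln (ln T%:R) / (2 * ln T%:R) ->
  \prod_(i | (q i <= T)%N) (1 + 8 * (expR (sg * ln (Q i)) / Q i)) <=
    expR (144 * d%:R * ln T%:R).
Proof.
move=> T1 y1 sgE; set y := ln (T%:R : R) in y1 sgE *.
have y0 : 0 < y by lra.
have ly0 : 0 < ln y by rewrite ln_gt0.
have sg0 : 0 < sg by rewrite sgE divr_gt0 // mulr_gt0.
apply: le_trans (prod_1D_le _) _.
  by move=> i _; rewrite mulr_ge0 // divr_ge0 // ltW // expR_gt0.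
rewrite ler_expR -mulr_sumr.
have -> : 144 * d%:R * y = 8 * (3 * (6 * d%:R * y)) by ring.
rewrite ler_pM2l //; apply: le_trans (ler_wpM2l _ (mertens_ideals R pp pq above (ltnW T1))) => //.
rewrite mulr_sumr; apply: ler_sum => i qT.
rewrite [X in _ <= X]mulrA ler_wpM2r ?invr_ge0 ?(ltW (Q0 i)) //.
set l := ln (Q i); set r := expR (ln y / 2).
have r0 : 0 < r by exact: expR_gt0.
have l2 : 1 / 2 <= l by apply: le_trans (ln2_ge R) (ler_ln_nat _ _ (q1 i)).
have ly : l <= y by apply: ler_ln_nat => //; exact: ltnW.
have r2 : r ^+ 2 = y.
  have -> : r ^+ 2 = expR (ln y) by rewrite /r -expRM_natl; congr expR; field.
  by rewrite lnK // posrE.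
have hr : expR (sg * l) <= r.
  rewrite ler_expR; apply: (@le_trans _ _ (sg * y)); first by rewrite ler_pM2l.
  by rewrite sgE le_eqVlt; apply/orP; left; apply/eqP; field; rewrite gt_eqF.
have sr : sg * r <= 1.
  have hl : ln y / 2 < r by rewrite /r -[X in X < _]expRK; apply: ln_sublinear; exact: expR_gt0.
  rewrite sgE mulrAC ler_pdivrMr ?mulr_gt0 // mul1r.
  by move: hl r0 r2; move: (r) (ln y) => r' z; nra.
have h := expR_le_1D (sg * l).
have : sg * l * expR (sg * l) <= l.
  apply: (@le_trans _ _ (sg * l * r)); last by nra.
  by rewrite ler_wpM2l // mulr_ge0 ?ltW //; lra.
lra.
Qed.

(** The condition on [y] says [20 * 6 * d / ln y <= 1 / 4], and [240 = 20 * 12]. *)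
Lemma distortion_product (y x : nat) : (1 < y)%N -> (0 < x)%N ->
  480 * d%:R <= ln (y%:R : R) ->
  \prod_(i | (q i <= x)%N) (1 + 20 / Q i) <=
    expR (240 * d%:R * ln y%:R) * expR (ln x%:R / 4).
Proof.
move=> y1 x0 hy.
apply: le_trans (prod_1D_le _) _; first by move=> i _; rewrite divr_ge0 // ltW.
rewrite -expRD ler_expR -mulr_sumr.
have h := sum_inv_le R pp pq above y1 x0.
have ly : 0 < ln (y%:R : R) by rewrite ln_gt0 // ltr1n.
have h2 : 6 * d%:R / ln y%:R <= 1 / 80 :> R.
  by rewrite ler_pdivrMr //; lra.
have h3 : 6 * d%:R / ln y%:R * ln x%:R <= 1 / 80 * ln x%:R :> R.
  by rewrite ler_wpM2r // ln_nat_ge0.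
move: h h3; set S := \sum_(i | _) _; set A := _ / _ * _; lra.
Qed.

(** Of [q ^ (- 7 / 4)], the part [q ^ (- 1 / 4)] is below [1 / T1], and [q ^ (- 3 / 2)] is at most
    [p ^ (- 3 / 2)]. *)
Lemma large_sum (T1 : nat) : (0 < T1)%N ->
  \sum_(t | (T1 ^ 4 < q t)%N) (Q t ^+ 2)^-1 * expR (ln (Q t) / 4) <= 3 * d%:R / T1%:R.
Proof.
move=> T0; have TR : 0 < T1%:R :> R by rewrite ltr0n.
rewrite mulrC; apply: le_trans (ler_wpM2l _ (sum_three_halves_ideals R pp above));
  last by rewrite invr_ge0 ltW.
rewrite mulr_sumr big_mkcond /=; apply: ler_sum => t _.
case: ifP => [Tq|_]; last by rewrite mulr_ge0 ?invr_ge0 ?ltW // expR_gt0.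
set l := ln (Q t).
have -> : (Q t ^+ 2)^-1 = expR (- (2 * l)).
  by rewrite expRN expRM_natl lnK // posrE.
have -> : (T1%:R : R)^-1 = expR (- ln T1%:R) by rewrite expRN lnK.
rewrite -!expRD ler_expR.
have h1 : ln (p t)%:R <= l by apply: ler_ln_nat; [exact: prime_gt0 | exact: pq].
have h2 : 4 * ln T1%:R <= l.
  have := ler_ln_nat R _ (ltnW Tq); rewrite natrX lnXn // mulr_natl => -> //.
  by rewrite expn_gt0 T0.
lra.
Qed.
End Bounds.

Lemma exp3_unbounded (x : R) : exists b, x <= 3 ^+ b.
Proof.
exists (Num.bound `|x|).
have h : x <= (Num.bound `|x|)%:R.
  by apply: le_trans (ler_norm x) (ltW (archi_boundP (normr_ge0 x))).
by apply: le_trans h _; rewrite -natrX ler_nat ltnW // ltn_expl.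
Qed.

Lemma initial_potential_lt1 (d : nat) : (0 < d)%N -> exists2 c : R, 0 < c &
  forall (T : eqType) (n J e : nat) (p q : 'I_J -> nat) (X : 'I_J -> seq T)
    (k : 'I_n -> 'I_J -> nat) (mem : 'I_n -> 'I_J -> pred T) (top : 'I_n -> 'I_J) (s : nat),
  box_system d e p q X k mem -> (0 < s)%N ->
  (forall a, (0 < k a (top a))%N) ->
  (forall a (i : 'I_J), (top a < i)%N -> k a i = 0%N) ->
  (forall a, (#|[set b | [forall i, k b i == k a i]]| <= s)%N) ->
  (forall a, expR (c * (ln (s%:R + 1) * ln (s%:R + 1)) / ln (ln (s%:R + 2))) <=
     (\prod_i q i ^ k a i)%N%:R) ->
  exists small, initial_potential R q k top small < 1.
Proof.
move=> d0; set D : R := d%:R; have D1 : 1 <= D by rewrite ler1n.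
pose y := (2 ^ (960 * d))%N.
have y1 : (1 < y)%N by rewrite -(expn0 2) ltn_exp2l // muln_gt0.
have ly : 480 * D <= ln (y%:R : R).
  by rewrite natrX lnXn // -[ln 2 *+ _]mulr_natl natrM -/D; have := ln2_ge R; nra.
pose C1 := expR (240 * D * ln (y%:R : R)).
have C10 : 0 < C1 by exact: expR_gt0.
(* The second moments come to at most [48 * s ^ 2 * C1 * D / T1] with [T1 >= s ^ 2 * 3 ^ b], hence
   to at most [1 / 2]. *)
have [b hb] := exp3_unbounded (96 * C1 * D).
pose B := (4 * (2 + b))%N.
have B1 : 1 <= B%:R :> R by rewrite ler1n.
(* Chosen to give [sg * lM >= (144 * D * B + 2) * L]: this absorbs the Euler product and the factor
   [s], and a last [L] leaves [1 / (s + 2)]. In [8 * B], [2 * B] cancels the denominator of [sg] and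
   4 comes from [L <= 2 * l]. *)
pose c := 8 * B%:R * (144 * D * B%:R + 2) : R.
have c0 : 0 < c by rewrite /c; nra.
exists c => // T n J e p q X k mem top s Bx s0 tg tm fib big.
have pp := box_prime Bx; have pq := box_le Bx; have above := box_above Bx.
pose T1 := ((s + 2) ^ (2 + b))%N; pose TT := (T1 ^ 4)%N.
have TTE : TT = ((s + 2) ^ B)%N by rewrite /TT /T1 -expnM mulnC.
pose L := ln ((s + 2)%:R : R).
have s3 : (3 <= s + 2)%N by rewrite addn2 !ltnS.
have L1 : 1 < L by apply: lt_le_trans (ln3_gt1 R) (ler_ln_nat _ _ s3).
have lT : ln (TT%:R : R) = B%:R * L.
  by rewrite TTE natrX lnXn ?mulr_natl // ltr0n addn2.
have lT1 : 1 < ln (TT%:R : R) by rewrite lT; nra.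
have T10 : (0 < T1)%N by rewrite expn_gt0 addn2.
have TT1 : (1 < TT)%N.
  rewrite ltnNge; apply/negP => h; move: lT1; rewrite ltNge => /negP; apply.
  by rewrite (le_trans _ ler01) // ln_le0 // lern1.
pose sg : R := ln (ln TT%:R) / (2 * ln TT%:R).
have lnL0 : 0 < ln L by rewrite ln_gt0.
have sg0 : 0 < sg.
  by rewrite divr_gt0 ?ln_gt0 // mulr_gt0 //; lra.
have sgh : sg <= 1 / 2.
  rewrite ler_pdivrMr; last by rewrite mulr_gt0 //; lra.
  have := ln_sublinear (lt_trans ltr01 lT1); lra.
pose l : R := ln (s%:R + 1).
pose lM := c * (l * l) / ln L.
have lME : lM = c * (ln (s%:R + 1) * ln (s%:R + 1)) / ln (ln (s%:R + 2)) by rewrite /lM /L /l natrD.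
pose small := [pred i | (q i <= TT)%N].
pose Y := expR (sg * lM).
exists small.
pose yy i := expR (sg * ln ((q i)%:R : R)).
have Qp i : 0 < (q i)%:R :> R by rewrite ltr0n (leq_trans (prime_gt0 (pp i))).
have Yle a : small (top a) -> Y <= \prod_i yy i ^+ k a i.
  move=> _.
  have -> : \prod_i yy i ^+ k a i = expR (sg * ln (\prod_i q i ^ k a i)%N%:R).
    rewrite ln_prod_nat; last by move=> i _; rewrite expn_gt0 -(ltr0n R) Qp.
    rewrite mulr_sumr expR_sum; apply: eq_bigr => i _.
    by rewrite natrX lnXn // /yy -expRM_natl -[ln _ *+ _]mulr_natl; congr expR; ring.
  rewrite ler_expR ler_pM2l //; have := big a; rewrite -lME => h.
  by rewrite -[X in X <= _]expRK ler_ln // posrE ?expR_gt0 // (lt_le_trans _ h) ?expR_gt0.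
have ip := @initial_potential_le R T n d J e p q X k mem Bx top small s yy Y tg tm _ fib _ _ _ Yle.
apply: le_lt_trans (ip _ _ _ _) _.
- by move=> i j ij /=; apply: leq_trans; exact: box_mono Bx _ _ ij.
- by move=> i; exact/ltW/expR_gt0.
- by move=> i _; exact: (rankin_ratio pp pq).
- exact: expR_gt0.
have S1 : s%:R / Y * \prod_(i | small i) (1 + 8 * (yy i / (q i)%:R)) <= 1 / 3.
  have h := rankin_product pp pq above TT1 lT1 (erefl sg).
  have sL : s%:R <= expR L.
    by rewrite /L lnK; [rewrite ler_nat leq_addr | rewrite posrE ltr0n addn2].
  have key : (144 * D * B%:R + 2) * L <= sg * lM.
    have l0 : 0 <= l by rewrite ln_ge0 // lerDr.
    have Ll : L <= 2 * l.
      have -> : 2 * l = ln ((s%:R + 1) ^+ 2) by rewrite lnXn ?mulr_natl // ltr_wpDl.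
      rewrite /L ler_ln ?posrE ?exprn_gt0 ?ltr_wpDl ?ltr0n ?addn2 // -addn2 natrD.
      have : 1 <= s%:R :> R by rewrite ler1n.
      nra.
    have Bp : 0 < B%:R :> R by lra.
    have Lp : 0 < L by lra.
    have r1 : 1 <= ln (B%:R * L) / ln L.
      rewrite ler_pdivlMr // mul1r ler_ln ?posrE ?mulr_gt0 //; nra.
    have -> : sg * lM = ln (B%:R * L) / ln L * ((144 * D * B%:R + 2) * (4 * l ^+ 2 / L)).
      by rewrite /sg lT /lM /c; field; rewrite ?gt_eqF.
    have h1 : L <= 4 * l ^+ 2 / L by rewrite ler_pdivlMr //; nra.
    have A0 : 0 <= 144 * D * B%:R + 2 by nra.
    apply: (@le_trans _ _ ((144 * D * B%:R + 2) * (4 * l ^+ 2 / L))).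
      exact: ler_wpM2l.
    by rewrite ler_peMl // mulr_ge0 // (le_trans _ h1) // ltW.
  have YV : Y^-1 = expR (- (sg * lM)) by rewrite expRN.
  apply: (@le_trans _ _ (expR L * expR (- (sg * lM)) * expR (144 * D * ln TT%:R))).
    rewrite YV; apply: ler_pM => //.
    - by rewrite mulr_ge0 // ltW // expR_gt0.
    - apply: prodr_ge0 => i _; rewrite addr_ge0 // mulr_ge0 // divr_ge0 // ltW //.
      exact: expR_gt0.
    - by rewrite ler_pM2r ?expR_gt0.
  rewrite -!expRD lT.
  apply: (@le_trans _ _ (expR (- L))); first by rewrite ler_expR; lra.
  by rewrite expRN /L lnK ?posrE ?ltr0n ?addn2 // div1r lef_pV2 ?posrE // ler_nat.
have S2 : \sum_(t | ~~ small t) 16 * (s ^ 2)%:R / (q t)%:R ^+ 2 *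
    \prod_(i < J | (i < t)%N) (1 + 20 / (q i)%:R) <= 1 / 2 :> R.
  apply: (@le_trans _ _ (\sum_(t | (TT < q t)%N) 16 * (s ^ 2)%:R * C1 *
     (((q t)%:R ^+ 2)^-1 * expR (ln (q t)%:R / 4)))).
    rewrite (eq_bigl (fun t => (TT < q t)%N)); last by move=> t; rewrite /= ltnNge.
    apply: ler_sum => t _.
    have h : \prod_(i < J | (i < t)%N) (1 + 20 / (q i)%:R) <=
        \prod_(i | (q i <= q t)%N) (1 + 20 / (q i)%:R) :> R.
      rewrite big_mkcond [X in _ <= X]big_mkcond /=; apply: ler_prod => i _.
      have g0 : 0 <= 20 / (q i)%:R :> R by rewrite divr_ge0 // ltW.
      apply/andP; split; first by case: ifP => // _; rewrite addr_ge0.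
      case: ifP => it; first by rewrite (box_mono Bx) // ltnW.
      by case: ifP => // _; rewrite lerDl.
    have qt0 : (0 < q t)%N by rewrite -(ltr0n R).
    have h' := le_trans h (distortion_product pp pq above y1 qt0 ly).
    have -> : 16 * (s ^ 2)%:R * C1 * (((q t)%:R ^+ 2)^-1 * expR (ln (q t)%:R / 4)) =
       16 * (s ^ 2)%:R / (q t)%:R ^+ 2 * (C1 * expR (ln (q t)%:R / 4)) by ring.
    apply: ler_wpM2l; last exact: h'.
    by apply: divr_ge0; [exact: mulr_ge0 | apply/exprn_ge0/ltW].
  rewrite -mulr_sumr.
  apply: le_trans (ler_wpM2l _ (large_sum pp pq above T10)) _.
    by rewrite !mulr_ge0 // ltW.
  have T1R : 0 < T1%:R :> R by rewrite ltr0n.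
  rewrite mulrA ler_pdivrMr //.
  have h1 : (s ^ 2)%:R * 3 ^+ b <= T1%:R :> R.
    rewrite -natrX -natrM ler_nat /T1 expnD leq_mul //; last first.
      by case: (b) => // b'; rewrite leq_exp2r.
    by rewrite leq_sqr leq_addr.
  have h2 : (s ^ 2)%:R * (96 * C1 * D) <= (s ^ 2)%:R * 3 ^+ b by rewrite ler_wpM2l.
  rewrite -/D; lra.
lra.
Qed.
End Constants.

Lemma expR_bound_ge1 (R : realType) (c : R) (s : nat) : (0 < c)%R -> (0 < s)%N ->
  (1 <= expR (c * (ln (s%:R + 1) * ln (s%:R + 1)) / ln (ln (s%:R + 2))))%R.
Proof.
move=> c0 s0; rewrite leNgt expR_lt1 -leNgt.
have l0 : (0 <= ln (s%:R + 1 : R))%R by rewrite ln_ge0 // lerDr.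
have l3 : (1 < ln (s%:R + 2 : R))%R.
  rewrite -natrD; apply: lt_le_trans (ln3_gt1 _) (ler_ln_nat _ _ _) => //.
  by rewrite addn2 !ltnS.
by rewrite divr_ge0 ?mulr_ge0 ?(ltW c0) // ltW // ln_gt0.
Qed.

(* Transfer to the standard reals and conclusion *)
From mathcomp Require Import Rstruct Rstruct_topology.

Lemma cover_boundE (c : R) (s : nat) : cover_bound c s =
  expR (c * (ln (s%:R + 1) * ln (s%:R + 1)) / ln (ln (s%:R + 2)))%R.
Proof.
rewrite /cover_bound RexpE !RlnE !RdivE !RmultE !RplusE INRE R1E.
by rewrite (_ : IZR 2 = 2%R) // (plus_IZR 1 1) RplusE.
Qed.

Lemma same_setbP (K : fieldExtType rat) (A B : K -> Prop) :
  same_set A B -> same_setb A B.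
Proof. by rewrite /same_setb; case: ClassicalEpsilon.excluded_middle_informative. Qed.

Theorem theorem1p2 (K : fieldExtType rat) :
  exists c : R, Rlt 0 c /\
  forall (n : nat) (a : 'I_n -> K) (I : 'I_n -> K -> Prop) (s : nat),
    (forall i, integral (a i)) ->
    (forall i, nonzero_ideal (I i)) ->
    (forall i, distinguishable (I i)) ->
    covering_system a I ->
    multiplicity I = s ->
    exists i : 'I_n, exists N : nat,
      ideal_norm_is (I i) N /\ Rle (INR N) (cover_bound c s).
Proof.
have d0 : (0 < \dim {:K})%N by exact: adim_gt0.
have [c c0 main] := @initial_potential_lt1 R (\dim {:K}) d0.
exists c; split; first exact/RltP.
move=> n a I s ia nI _ cov mult.
apply: contrapT => noSmall.
have [J [e [p [q [X [k [mem [Bx crt same nrm]]]]]]]] := ideals_box_system ia nI.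
have fib b : (#|[set l | same_setb (I l) (I b)]| <= s)%N.
  by rewrite -mult /multiplicity (leq_bigmax b).
have s0 : (0 < s)%N.
  have [i0 _] := cov _ (integralO0 K); apply: leq_trans (fib i0).
  by apply/card_gt0P; exists i0; rewrite inE same_setbP.
have big b : (expR (c * (ln (s%:R + 1) * ln (s%:R + 1)) / ln (ln (s%:R + 2))) <
    (\prod_i q i ^ k b i)%N%:R)%R.
  have [N hN NQ] := nrm b.
  rewrite -cover_boundE ltNge; apply/negP => h; apply: noSmall; exists b, N; split=> //.
  by apply/RleP; rewrite INRE; apply: le_trans h; rewrite ler_nat.
(* The bound is at least 1, so a modulus beyond it has some positive exponent; this is what makes
   [top] well defined. *)
have ex b : exists i, (0 < k b i)%N.
  apply: contrapT => /forallNP k0.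
  have := le_lt_trans (expR_bound_ge1 c0 s0) (big b).
  rewrite big1 ?ltxx // => i _.
  by have /negP := k0 i; rewrite -eqn0Ngt => /eqP ->.
have htop b : exists t : 'I_J, (0 < k b t)%N /\ forall i : 'I_J, (t < i)%N -> k b i = 0%N.
  have [i0 k0] := ex b.
  case: (@arg_maxnP _ i0 (fun i => 0 < k b i)%N (fun i => i : nat) k0) => t kt mx.
  exists t; split=> // i ti; apply/eqP; rewrite -leqn0 leqNgt; apply/negP => /mx.
  by rewrite /geq /= leqNgt ti.
have [top topP] := choice htop.
have [||||small P0] := main _ _ _ _ _ _ _ _ _ top s Bx s0.
- by move=> b; case: (topP b).
- by move=> b; case: (topP b).
- move=> b; apply: leq_trans (fib b); apply: subset_leq_card.
  apply/fintype.subsetP => l; rewrite !inE => /forallP h.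
  by apply: same_setbP; apply: same => i; exact/eqP.
- by move=> b; exact: ltW.
have [x xX xm] := boxes_do_not_cover Bx P0.
have [z iz zP] := crt x xX.
have [i Ii] := cov z iz.
by have [j] := xm i; rewrite (zP i Ii j).
Qed.
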